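(* Let $r>0$ and let $V,M$ be as in the context, with $M$ symmetric, i.e. $M(-v)=M(v)$. Let $v_{\max}=\sup V$, $D=\int_Vv^2M(v)\,dv$, and let $c^*(M)$ be the minimal speed defined in the context. Then: (a) [Scaling] For $\sigma>0$, define $M_\sigma(v)=\sigma^{-1}M(\sigma^{-1}v)$ and rescale the velocity set accordingly, $V_\sigma=\sigma V$. Then $c^*(M_\sigma)=\sigma\,c^*(M)$. (b) [Rearrangement] Let $M^\star$ be the Schwarz decreasing rearrangement of $M$ and $M_\star=-(-M)^\star$ the Schwarz increasing rearrangement of $M$. Then $c^*(M^\star)\le c^*(M)\le c^*(M_\star)$. (c) [Comparison] If $r<1$ then $$\frac{2\sqrt{rD}}{1+r}\le c^*(M)\le\frac{2\sqrt r}{1+r}\,v_{\max},$$ whereas if $r\ge1$ then $\sqrt D\le c^*(M)\le v_{\max}$. (d) [Diffusion limit] In the diffusion limit $(r,t,x)\mapsto(\varepsilon^2r,\frac{t}{\varepsilon^2},\frac{x}{\varepsilon})$, the dispersion relation for the rescaled equation $$\varepsilon^2\partial_tg_\varepsilon+\varepsilon v\,\partial_xg_\varepsilon=\big(M(v)\rho_{g_\varepsilon}-g_\varepsilon\big)+\varepsilon^2r\rho_{g_\varepsilon}\big(M(v)-g_\varepsilon\big)$$ reads $$(1+\varepsilon^2r)\int_V\frac{M(v)}{1+\varepsilon^2\lambda(c-v/\varepsilon)}\,dv=1,$$ and the corresponding minimal speed $c^*_\varepsilon$ satisfies $\lim_{\varepsilon\to0}c^*_\varepsilon=2\sqrt{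rD}$.
   Context: The set $V\subset\mathbb{R}$ is compact and symmetric ($V=-V$), $V=\operatorname{supp}M$, and $M:V\to[0,\infty)$ is continuous with $\int_VM\,dv=1$, $\int_VvM\,dv=0$, $\int_Vv^2M\,dv=D<\infty$. For a function $g$, $\rho_g=\int_Vg\,dv$. Minimal speed. For a probability density $M$ on a compact symmetric set $V$ with $v_{\max}=\sup V$, and for $c\in[0,v_{\max})$, $\lambda\in[0,\frac1{v_{\max}-c}]$, put $I(\lambda;c)=(1+r)\int_V\frac{M(v)}{1+\lambda(c-v)}\,dv$ (possibly $+\infty$ at the right endpoint). The relation $I(\lambda;c)=1$ is the dispersion relation: it expresses that $e^{-\lambda x}F(v)$, with $F\ge0$ and $\int_VF=1$, solves the linearization at $0$ of the travelling wave equation $(v-c)\partial_xf=(M\rho_f-f)+r\rho_f(M-f)$. The minimal speed $c^*(M)$ is the smallest $c\in[0,v_{\max})$ for which there is $\lambda\in(0,\frac1{v_{\max}-c}]$ with $I(\lambda;c)=1$. Rearrangements in (b): $M$ is extended by $0$ to $[-v_{\max},v_{\max}]$ (which does not change $I$ or $c^*(M)$); $M^\star$ (resp. $M_\star$) is the even function on $[-v_{\max},v_{\max}]$, nonincreasing (resp. nondecreasing) on $[0,v_{\max}]$, equimeasurable with this extension of $M$. The speeds $c^*(M^\star)$ and $c^*(M_\star)$ are computed with the velocity set $[-v_{\max},v_{\max}]$. In (d), the dispersion relation is the condition for the linearization at $0$ of the rescaled equation, in the frame moving at speed $c$, to have a nonnegative solution $e^{-\lambda z}F(v)$ with $\int_VF=1$;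 $c_\varepsilon^*$ is the smallest $c\in[0,v_{\max}/\varepsilon)$ for which there is $\lambda>0$ with $1+\varepsilon^2\lambda(c-v/\varepsilon)\ge0$ for all $v\in V$ satisfying the relation. *)

(* Defs.v *)
From HB Require Import structures.
From mathcomp Require Import all_boot all_order all_algebra.
From mathcomp Require Import all_classical all_reals all_analysis.

Set Implicit Arguments.
Unset Strict Implicit.
Unset Printing Implicit Defensive.

Import Order.TTheory GRing.Theory Num.Theory.
Import numFieldNormedType.Exports.

Local Open Scope classical_set_scope.
Local Open Scope ring_scope.

Notation mu := (@lebesgue_measure _).

(* The topological support, relative to the closed set V, of a function on V. *)
Definition supp_on (R : realType) (V : set R) (M : R -> R) : set R :=
  closure (V `&` [set v | M v != 0]).

Definition is_min (R : realType) (A : set R) (c : R) : Prop :=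
  A c /\ lbound A c.

(* I(lambda; c), with values in [0, +oo] for the pairs (lambda, c) considered
   below.  At lambda = 1 / (sup V - c) the denominator vanishes only at
   v = sup V, so the convention x / 0 = 0 affects a single point, which is
   Lebesgue-null. *)
Definition dispI (R : realType) (r : R) (V : set R) (M : R -> R)
    (lambda c : R) : \bar R :=
  ((1 + r)%:E * \int[mu]_(v in V) (M v / (1 + lambda * (c - v)))%:E)%E.

Definition speeds (R : realType) (r : R) (V : set R) (M : R -> R) : set R :=
  [set c | 0 <= c < sup V /\
    exists lambda, 0 < lambda <= (sup V - c)^-1 /\
                   dispI r V M lambda c = 1%E].

Definition is_minimal_speed (R : realType) (r : R) (V : set R) (M : R -> R)
    (c : R) : Prop := is_min (speeds r V M) c.

Definition sym_itv (R : realType) (a : R) : set R := `[- a, a].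

(* f and g have superlevel sets of equal measure in E. *)
Definition equimeasurable_on (R : realType) (E : set R) (f g : R -> R) : Prop :=
  forall t : R, mu (E `&` [set v | t < f v]) = mu (E `&` [set v | t < g v]).

(* N is a version of the Schwarz decreasing rearrangement of M; M \_ V is the
   extension of M by 0 outside V.  Rearrangements are only determined up to
   the values at the jumps, hence a predicate. *)
Definition decreasing_rearrangement (R : realType) (V : set R)
    (M N : R -> R) : Prop :=
  [/\ forall v, sym_itv (sup V) v -> N (- v) = N v,
      forall v w, 0 <= v -> v <= w -> w <= sup V -> N w <= N v
    & equimeasurable_on (sym_itv (sup V)) N (M \_ V)].

Definition increasing_rearrangement (R : realType) (V : set R)
    (M N : R -> R) : Prop :=
  [/\ forall v, sym_itv (sup V) v -> N (- v) = N v,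
      forall v w, 0 <= v -> v <= w -> w <= sup V -> N v <= N w
    & equimeasurable_on (sym_itv (sup V)) N (M \_ V)].

Definition rho (R : realType) (V : set R) (g : R -> R) : R :=
  (\int[mu]_(v in V) g v)%R.

(* Left-hand side minus right-hand side of the rescaled kinetic equation, for
   a density g = g(t, x, v). *)
Definition rescaled_residual (R : realType) (r : R) (V : set R) (M : R -> R)
    (eps : R) (g : R -> R -> R -> R) (t x v : R) : R :=
  eps ^+ 2 * derive1 (fun s => g s x v) t + eps * v * derive1 (fun y => g t y v) x
  - ((M v * rho V (g t x) - g t x v)
     + eps ^+ 2 * r * rho V (g t x) * (M v - g t x v)).

(* The linearization at 0 is the Gateaux derivative at 0, in the direction g,
   of the residual. *)
Definition solves_linearization_at0 (R : realType) (r : R) (V : set R)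
    (M : R -> R) (eps : R) (g : R -> R -> R -> R) : Prop :=
  forall t x : R, {ae mu, forall v, V v ->
    is_derive (0 : R) (1 : R)
      (fun d : R =>
         rescaled_residual r V M eps (fun t' x' v' => d * g t' x' v') t x v)
      (0 : R)}.

(* Existence of a solution exp(- lambda z) F(v), z = x - c t, with F >= 0
   of unit mass. *)
Definition has_exponential_solution (R : realType) (r : R) (V : set R)
    (M : R -> R) (eps lambda c : R) : Prop :=
  exists F : R -> R,
    [/\ forall v, V v -> 0 <= F v,
        mu.-integrable V (EFin \o F),
        (\int[mu]_(v in V) (F v)%:E = 1)%E
      & solves_linearization_at0 r V M eps
          (fun t x v => expR (- lambda * (x - c * t)) * F v)].

Definition dispI_eps (R : realType) (r : R) (V : set R) (M : R -> R)
    (eps lambda c : R) : \bar R :=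
  ((1 + eps ^+ 2 * r)%:E *
   \int[mu]_(v in V) (M v / (1 + eps ^+ 2 * lambda * (c - v / eps)))%:E)%E.

Definition admissible_eps (R : realType) (V : set R) (eps lambda c : R) : Prop :=
  forall v, V v -> 0 <= 1 + eps ^+ 2 * lambda * (c - v / eps).

Definition speeds_eps (R : realType) (r : R) (V : set R) (M : R -> R)
    (eps : R) : set R :=
  [set c | 0 <= c < sup V / eps /\
    exists lambda, [/\ 0 < lambda, admissible_eps V eps lambda c
                     & dispI_eps r V M eps lambda c = 1%E]].

(* Main.v *)
Require Import Defs.
From HB Require Import structures.
From mathcomp Require Import all_boot all_order all_algebra.
From mathcomp Require Import all_classical all_reals all_analysis.
From mathcomp Require Import measurable_realfun ring lra.
Import Order.TTheory GRing.Theory Num.Theory.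
Import numFieldNormedType.Exports.
Local Open Scope classical_set_scope.
Local Open Scope ring_scope.

(** Put a = sup V and extend M by zero to f, an even probability density on
    ]-a, a[.  For lambda > 0 and c in [0, a[ set s = lambda / (1 + lambda c).
    Then 1 + lambda (c - v) = (1 + lambda c) (1 - s v) and
    1 / (1 + lambda c) = 1 - s c, while the condition lambda <= 1 / (a - c)
    becomes s <= 1 / a.  As f is even, averaging over v and -v turns the
    dispersion relation into
      (1 + r) (1 - s c) J(s) = 1,   J(s) = int f(v) / (1 - s^2 v^2) dv,
    which can be solved for c:
      c = C(s) := (1 - 1 / ((1 + r) J(s))) / s,   0 < s <= 1 / a,
    where 1 / J(s) stands for 0 if J(s) is infinite.  So the minimal speed is
    the minimum of the one-variable function C ([branch_minimal_speed]), and
    everything follows from properties of J.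

    Existence of the minimum.  J is nondecreasing, whereas
    (1 - s^2 a^2) J(s) is nonincreasing; together these make 1 / J continuous
    on [0, 1 / a[, and monotone convergence gives left continuity at 1 / a.
    Dominated convergence shows that (1 - s^2 a^2) J(s) tends to 0 as s tends
    to 1 / a, so that C takes values below a.  As C(s) >= r / ((1 + r) s) is
    large for small s, C attains its minimum, and the minimum is less than a
    ([branch_speed_min]); hence J is finite at a minimizer.

    (a) The substitution v -> sigma v carries one dispersion relation to the
    other.  (b) The weight 1 / (1 - s^2 v^2) is even and nondecreasing in |v|;
    by the layer cake formula and the bathtub principle, moving mass towards 0
    lowers J(s), hence C(s), for every s, and moving mass outwards raises them
    ([le_integral_rearrangement]).  (c) Convexity of y -> 1 / (1 - y) gives
    1 / J(s) <= 1 - s^2 D, and |v| <= a gives 1 / J(s) >= 1 - s^2 a^2.  So C(s)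
    lies between (r + s^2 D) / ((1 + r) s) and (r + s^2 a^2) / ((1 + r) s).
    The former is at least 2 sqrt (r D) / (1 + r), and at least sqrt D if
    r >= 1, because s sqrt D <= 1; if r < 1, the latter can be evaluated at
    s = sqrt r / a.
    (d) The rescaled relation for (lambda, c) is the original one for
    (eps lambda, eps c) with r replaced by eps^2 r.  The bound of (c) gives
    c_eps >= 2 sqrt (r D) / (1 + eps^2 r), and the choice s = eps sqrt (r / D),
    for which J(s) = 1 + s^2 D + o(s^2), gives a matching upper bound. *)

Set Implicit Arguments.
Unset Strict Implicit.
Unset Printing Implicit Defensive.

(** * Lebesgue integrals under dilations and reflections *)

Definition osym_itv (R : realType) (a : R) : set R := `]- a, a[.

Section Substitution.
Context {R : realType}.
Implicit Types (a s : R) (h : R -> \bar R).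

Lemma measurable_scale s :
  measurable_fun [set: R] ( *%R s : R -> measurableTypeR R).
Proof. exact: mulrl_measurable. Qed.

Let scaled_measure s (s_gt0 : 0 < s) : {measure set (measurableTypeR R) -> \bar R} :=
  mscale (NngNum (ltW s_gt0))
    (measure_function_pushforward__canonical__measure_function_Measure
      mu (measurable_scale s)).

Lemma lebesgue_measure_pushforward_scale s (s_gt0 : 0 < s) (A : set R) :
  measurable A -> mu A = scaled_measure s_gt0 A.
Proof.
move=> mA; apply: lebesgue_measure_unique => //.
move=> _ [[x y]] _ <-.
have E : ( *%R s) @^-1` `]x, y] = `]s^-1 * x, s^-1 * y]%classic.
  by apply/seteqP; split => v /=; rewrite !in_itv/= ltr_pdivrMl// ler_pdivlMl.
rewrite -[RHS]/(s%:E * mu (( *%R s) @^-1` `]x, y]))%E E.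
rewrite !lebesgue_measure_itv/= !lte_fin ltr_pM2l ?invr_gt0//.
case: ifPn => _; last by rewrite mule0.
by rewrite -!EFinD -EFinM -mulrBr mulrA divff ?gt_eqF// mul1r.
Qed.

Lemma ge0_integral_scale s (s_gt0 : 0 < s) (A : set R) h :
  measurable A -> measurable_fun A h -> (forall v, A v -> 0 <= h v)%E ->
  (\int[mu]_(v in A) h v = s%:E * \int[mu]_(v in *%R s @^-1` A) h (s * v)%R)%E.
Proof.
move=> mA mh h0.
rewrite (eq_measure_integral (scaled_measure s_gt0)); last first.
  by move=> B mB _; exact: lebesgue_measure_pushforward_scale.
rewrite ge0_integral_mscale//= ge0_integral_pushforward//.
by move=> y; rewrite inE => /h0.
Qed.

Lemma ge0_integral_reflect a h :
  measurable_fun (osym_itv a) h -> (forall v, osym_itv a v -> (0 <= h v)%E) ->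
  (\int[mu]_(v in osym_itv a) h v = \int[mu]_(v in osym_itv a) h (- v)%R)%E.
Proof.
move=> mh h0.
rewrite (eq_measure_integral
  (pushforward mu (-%R : R -> measurableTypeR R))); last first.
  by move=> B mB _; exact/esym/lebesgue_measureN.
rewrite ge0_integral_pushforward//=; first last.
- by move=> y; rewrite inE => /h0.
- exact: measurable_itv.
by rewrite opp_preimage_itvbndbnd/= opprK.
Qed.

End Substitution.

(** * The resolvent integral of an even density *)

Lemma measurable_inv (R : realType) : measurable_fun [set: R] (@GRing.inv R).
Proof.
rewrite -(setUv [set 0 : R]); apply/measurable_funU => //; first exact: measurableC.
split; first exact: measurable_fun_set1.
apply: subspace_continuous_measurable_fun; first exact: measurableC.
apply: continuous_in_subspaceT => x; rewrite inE/= => /eqP x0.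
exact: inv_continuous.
Qed.

Lemma measurable_dispersion_kernel (R : realType) (E : set R) (lambda c : R) :
  measurable_fun E (fun v => (1 + lambda * (c - v))^-1).
Proof.
apply: measurable_funTS; apply: measurableT_comp; first exact: measurable_inv.
apply: measurable_funD; first exact: measurable_cst.
apply: measurable_funM; first exact: measurable_cst.
by apply: measurable_funB; first exact: measurable_cst.
Qed.

(** The common normal form of the densities to be compared, namely the zero
    extension of M and its rearrangements.  The endpoints are left out so that
    1 - s v is positive on the whole domain even for s = 1 / a. *)
Definition profile (R : realType) (a : R) (f : R -> R) : Prop :=
  [/\ 0 < a, measurable_fun [set: R] f, forall v, 0 <= f v,
      forall v, f (- v) = f v
    & (\int[mu]_(v in osym_itv a) (f v)%:E = 1)%E].

(** The even part in v of the kernel 1 / (1 - s v), which is the kernel of the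
    dispersion relation up to a factor; see [dispersion_factorization]. *)
Definition resolvent (R : realType) (a : R) (f : R -> R) (s : R) : \bar R :=
  (\int[mu]_(v in osym_itv a) (f v / (1 - (s * v) ^+ 2))%:E)%E.

Section Resolvent.
Context {R : realType} {a : R} {f : R -> R}.
Context (hf : profile a f).
Implicit Types (s v k : R).

Let a_gt0 : 0 < a. Proof. by case: hf. Qed.
Let mf : measurable_fun [set: R] f. Proof. by case: hf. Qed.
Let f_ge0 v : 0 <= f v. Proof. by case: hf. Qed.
Let mass1 : (\int[mu]_(v in osym_itv a) (f v)%:E = 1)%E. Proof. by case: hf. Qed.
Let mO : measurable (osym_itv a). Proof. exact: measurable_itv. Qed.

Lemma osym_itvP v : osym_itv a v -> - a < v < a.
Proof. by rewrite /osym_itv/= in_itv. Qed.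

Lemma sqr_lt_osym v : osym_itv a v -> v ^+ 2 < a ^+ 2.
Proof. by move=> /osym_itvP/andP[v1 v2]; nra. Qed.

Lemma osym_sqr_lt1 s v : 0 <= s -> s * a <= 1 -> osym_itv a v -> (s * v) ^+ 2 < 1.
Proof.
move=> s0 sa /sqr_lt_osym va; rewrite exprMn.
have [->|s_neq0] := eqVneq s 0; first by rewrite expr0n mul0r.
have s2 : 0 < s ^+ 2 by rewrite exprn_even_gt0.
rewrite (@lt_le_trans _ _ (s ^+ 2 * a ^+ 2)) ?ltr_pM2l// -exprMn.
by rewrite expr_le1// mulr_ge0// ltW.
Qed.

Lemma osym_sqr_le s v : osym_itv a v -> (s * v) ^+ 2 <= (s * a) ^+ 2.
Proof.
by move=> /sqr_lt_osym/ltW va; rewrite !exprMn ler_wpM2l ?sqr_ge0.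
Qed.

Lemma measurable_resolvent_integrand s :
  measurable_fun [set: R] (fun v => f v / (1 - (s * v) ^+ 2)).
Proof.
apply: measurable_funM => //; apply: measurableT_comp; first exact: measurable_inv.
apply: measurable_funB; first exact: measurable_cst.
by apply: measurable_funX; exact: mulrl_measurable.
Qed.

Let mres s : measurable_fun (osym_itv a) (fun v => (f v / (1 - (s * v) ^+ 2))%:E).
Proof.
apply/measurable_EFinP; apply: measurable_funTS; exact: measurable_resolvent_integrand.
Qed.

Let mfE : measurable_fun (osym_itv a) (fun v => (f v)%:E).
Proof. by apply/measurable_EFinP; apply: measurable_funTS. Qed.

Lemma resolvent_integrand_ge0 s v : 0 <= s -> s * a <= 1 -> osym_itv a v ->
  0 <= f v / (1 - (s * v) ^+ 2).
Proof.
move=> s0 sa Ov; rewrite divr_ge0// subr_ge0 ltW//; exact: osym_sqr_lt1.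
Qed.

Lemma resolvent_ge0 s : 0 <= s -> s * a <= 1 -> (0 <= resolvent a f s)%E.
Proof.
move=> s0 sa; apply: integral_ge0 => v Ov; rewrite lee_fin.
exact: resolvent_integrand_ge0.
Qed.

Lemma resolvent0 : resolvent a f 0 = 1%E.
Proof.
rewrite -mass1; apply: eq_integral => v _.
by rewrite mul0r expr0n subr0 divr1.
Qed.

Lemma le_resolvent s t : 0 <= s -> s <= t -> t * a <= 1 ->
  (resolvent a f s <= resolvent a f t)%E.
Proof.
move=> s0 st ta; have sa : s * a <= 1 by rewrite (le_trans _ ta)// ler_pM2r.
apply: ge0_le_integral => //; [|exact: mres..|] => v Ov.
  by rewrite lee_fin resolvent_integrand_ge0.
have h1 := osym_sqr_lt1 s0 sa Ov; have h2 := osym_sqr_lt1 (le_trans s0 st) ta Ov.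
rewrite lee_fin ler_wpM2l// lef_pV2 ?posrE ?subr_gt0// lerD2l lerN2 !exprMn.
by rewrite ler_wpM2r ?sqr_ge0// ler_sqr ?nnegrE// (le_trans s0).
Qed.

Lemma resolvent_ge1 s : 0 <= s -> s * a <= 1 -> (1 <= resolvent a f s)%E.
Proof. by move=> s0 sa; rewrite -resolvent0 le_resolvent. Qed.

(** Opposite to the monotonicity of the integral itself: for s <= t the
    quotient (1 - s^2 y) / (1 - t^2 y) is nondecreasing in y and y = v^2 < a^2.
    Together the two monotonicities replace any estimate of the modulus of
    continuity in s < 1 / a. *)
Lemma resolvent_ratio s t : 0 <= s -> s <= t -> t * a <= 1 ->
  ((1 - (t * a) ^+ 2)%:E * resolvent a f t <=
   (1 - (s * a) ^+ 2)%:E * resolvent a f s)%E.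
Proof.
move=> s0 st ta; have t0 := le_trans s0 st.
have sa : s * a <= 1 by rewrite (le_trans _ ta)// ler_pM2r.
have X0 u : 0 <= u -> u * a <= 1 -> 0 <= 1 - (u * a) ^+ 2.
  by move=> u0 ua; rewrite subr_ge0 expr_le1// mulr_ge0// ltW.
have ZE u : 0 <= u -> u * a <= 1 -> ((1 - (u * a) ^+ 2)%:E * resolvent a f u =
    \int[mu]_(v in osym_itv a)
      ((1 - (u * a) ^+ 2)%:E * (f v / (1 - (u * v) ^+ 2))%:E))%E.
  move=> u0 ua; rewrite ge0_integralZl ?lee_fin ?X0//; first exact: mres.
  by move=> v Ov; rewrite lee_fin resolvent_integrand_ge0.
have mZ u : measurable_fun (osym_itv a)
    (fun v => (1 - (u * a) ^+ 2)%:E * (f v / (1 - (u * v) ^+ 2))%:E)%E.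
  by apply: emeasurable_funM; [exact: measurable_cst|exact: mres].
rewrite !ZE//; apply: ge0_le_integral => //; [|exact: mZ..|] => v Ov.
  by rewrite -EFinM lee_fin mulr_ge0 ?X0// resolvent_integrand_ge0.
rewrite -!EFinM lee_fin.
have h1 := osym_sqr_lt1 s0 sa Ov; have h2 := osym_sqr_lt1 t0 ta Ov.
rewrite [leLHS]mulrCA [leRHS]mulrCA ler_wpM2l// ler_pdivrMr ?subr_gt0//.
rewrite mulrAC ler_pdivlMr ?subr_gt0// -subr_ge0.
have -> : (1 - (s * a) ^+ 2) * (1 - (t * v) ^+ 2) -
    (1 - (t * a) ^+ 2) * (1 - (s * v) ^+ 2) =
    (t ^+ 2 - s ^+ 2) * (a ^+ 2 - v ^+ 2) by ring.
by rewrite mulr_ge0// subr_ge0 ?(ltW (sqr_lt_osym Ov))// ler_sqr ?nnegrE.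
Qed.

Lemma resolvent_le_edge s : 0 <= s -> s * a <= 1 ->
  ((1 - (s * a) ^+ 2)%:E * resolvent a f s <= 1)%E.
Proof.
move=> s0 sa; have := resolvent_ratio (lexx 0) s0 sa.
by rewrite resolvent0 mul0r expr0n subr0 mule1.
Qed.

Lemma resolvent_lty s : 0 <= s -> s * a < 1 -> (resolvent a f s < +oo)%E.
Proof.
move=> s0 sa; rewrite ltey; apply/eqP => Jy.
have X0 : 0 < 1 - (s * a) ^+ 2 by rewrite subr_gt0 expr_lt1// mulr_ge0// ltW.
by have := resolvent_le_edge s0 (ltW sa); rewrite Jy mulry gtr0_sg// mul1e.
Qed.

Let msq : measurable_fun (osym_itv a) (fun v => (v ^+ 2 * f v)%:E).
Proof.
apply/measurable_EFinP; apply: measurable_funTS; apply: measurable_funM => //.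
Qed.

Let vf_ge0 v : 0 <= v ^+ 2 * f v. Proof. by rewrite mulr_ge0 ?sqr_ge0. Qed.

Let fE_ge0 v : osym_itv a v -> (0 <= (f v)%:E)%E. Proof. by rewrite lee_fin. Qed.

Let vfE_ge0 v : osym_itv a v -> (0 <= (v ^+ 2 * f v)%:E)%E.
Proof. by rewrite lee_fin. Qed.

(** Integrated form of the tangent inequality 1 / (1 - y) >= 2 k - k^2 (1 - y),
    which holds because (1 - k (1 - y))^2 >= 0.  Jensen's inequality for
    1 / (1 - y) results from the choice k = J(s); both sides have been moved so
    that only integrals of nonnegative functions occur. *)
Lemma resolvent_ge_tangent D s k :
  (\int[mu]_(v in osym_itv a) (v ^+ 2 * f v)%:E = D%:E)%E ->
  0 <= s -> s * a <= 1 -> 0 <= k ->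
  ((2 * k + k ^+ 2 * s ^+ 2 * D)%:E <= resolvent a f s + (k ^+ 2)%:E)%E.
Proof.
move=> hD s0 sa k0; have ksD : 0 <= k ^+ 2 * s ^+ 2 by rewrite mulr_ge0 ?sqr_ge0.
have -> : ((2 * k + k ^+ 2 * s ^+ 2 * D)%:E =
    \int[mu]_(v in osym_itv a)
      ((2 * k)%:E * (f v)%:E + (k ^+ 2 * s ^+ 2)%:E * (v ^+ 2 * f v)%:E))%E.
  rewrite ge0_integralD//; first last.
  - by apply: emeasurable_funM; [exact: measurable_cst|exact: msq].
  - by move=> v _; rewrite -EFinM lee_fin mulr_ge0.
  - by apply: emeasurable_funM; [exact: measurable_cst|exact: mfE].
  - by move=> v _; rewrite -EFinM lee_fin mulr_ge0// mulr_ge0.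
  rewrite ge0_integralZl ?lee_fin ?mulr_ge0// ge0_integralZl ?lee_fin//.
  by rewrite mass1 hD mule1 -EFinM -EFinD.
have -> : (resolvent a f s + (k ^+ 2)%:E = \int[mu]_(v in osym_itv a)
      ((f v / (1 - (s * v) ^+ 2))%:E + (k ^+ 2)%:E * (f v)%:E))%E.
  rewrite ge0_integralD//; first last.
  - by apply: emeasurable_funM; [exact: measurable_cst|exact: mfE].
  - by move=> v _; rewrite -EFinM lee_fin mulr_ge0 ?sqr_ge0.
  - exact: mres.
  - by move=> v Ov; rewrite lee_fin resolvent_integrand_ge0.
  by rewrite ge0_integralZl ?lee_fin ?sqr_ge0// mass1 mule1.
apply: ge0_le_integral => //.
- by move=> v _; rewrite -!EFinM -EFinD lee_fin addr_ge0// mulr_ge0// mulr_ge0.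
- apply: emeasurable_funD; apply: emeasurable_funM; try exact: measurable_cst.
    exact: mfE.
  exact: msq.
- apply: emeasurable_funD; first exact: mres.
  by apply: emeasurable_funM; [exact: measurable_cst|exact: mfE].
move=> v Ov; rewrite -!EFinM -!EFinD lee_fin.
have y1 := osym_sqr_lt1 s0 sa Ov; set y := (s * v) ^+ 2 in y1 *.
have -> : 2 * k * f v + k ^+ 2 * s ^+ 2 * (v ^+ 2 * f v) =
    f v * (2 * k + k ^+ 2 * y) by rewrite /y; ring.
have -> : f v / (1 - y) + k ^+ 2 * f v = f v * ((1 - y)^-1 + k ^+ 2) by ring.
rewrite ler_wpM2l// -subr_ge0.
have y0 : 1 - y != 0 by rewrite gt_eqF// subr_gt0.
have -> : (1 - y)^-1 + k ^+ 2 - (2 * k + k ^+ 2 * y) =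
    (1 - k * (1 - y)) ^+ 2 / (1 - y) by field.
by rewrite divr_ge0 ?sqr_ge0// subr_ge0 ltW.
Qed.

(** From 1 / (1 - y) = 1 + y / (1 - y) and y = s^2 v^2 <= s^2 a^2 in the last
    denominator. *)
Lemma resolvent_le_variance D s :
  (\int[mu]_(v in osym_itv a) (v ^+ 2 * f v)%:E = D%:E)%E ->
  0 <= s -> s * a < 1 ->
  (resolvent a f s <= (1 + s ^+ 2 * D / (1 - (s * a) ^+ 2))%:E)%E.
Proof.
move=> hD s0 sa.
have X0 : 0 < 1 - (s * a) ^+ 2 by rewrite subr_gt0 expr_lt1// mulr_ge0// ltW.
have k0 : 0 <= s ^+ 2 / (1 - (s * a) ^+ 2) by rewrite divr_ge0 ?sqr_ge0// ltW.
have -> : ((1 + s ^+ 2 * D / (1 - (s * a) ^+ 2))%:E =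
    \int[mu]_(v in osym_itv a)
      ((f v)%:E + (s ^+ 2 / (1 - (s * a) ^+ 2))%:E * (v ^+ 2 * f v)%:E))%E.
  rewrite ge0_integralD//; first last.
  - by apply: emeasurable_funM; [exact: measurable_cst|exact: msq].
  - by move=> v _; rewrite -EFinM lee_fin mulr_ge0.
  rewrite ge0_integralZl ?lee_fin//.
  by rewrite mass1 hD -EFinM -EFinD mulrAC.
apply: ge0_le_integral => //.
- by move=> v Ov; rewrite lee_fin resolvent_integrand_ge0// ltW.
- exact: mres.
- apply: emeasurable_funD; first exact: mfE.
  by apply: emeasurable_funM; [exact: measurable_cst|exact: msq].
move=> v Ov; rewrite -!EFinM -!EFinD lee_fin.
have yY := osym_sqr_le s Ov; rewrite exprMn in yY *.
have Y1 : 1 - (s * a) ^+ 2 <= 1 - s ^+ 2 * v ^+ 2 by rewrite lerD2l lerN2.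
have y0 : 0 < 1 - s ^+ 2 * v ^+ 2 by exact: lt_le_trans Y1.
have -> : f v + s ^+ 2 / (1 - (s * a) ^+ 2) * (v ^+ 2 * f v) =
  f v * (1 + s ^+ 2 * v ^+ 2 / (1 - (s * a) ^+ 2)) by ring.
rewrite ler_wpM2l//.
have -> : (1 - s ^+ 2 * v ^+ 2)^-1 =
    1 + s ^+ 2 * v ^+ 2 / (1 - s ^+ 2 * v ^+ 2).
  by move: y0; set y := s ^+ 2 * v ^+ 2 => y0; field; rewrite gt_eqF.
rewrite lerD2l ler_wpM2l//; first by rewrite mulr_ge0 ?sqr_ge0.
by rewrite lef_pV2 ?posrE.
Qed.

(** A sequence increasing to 1 / a along which the convergence theorems apply. *)
Let edge (n : nat) : R := (1 - n.+1%:R^-1) / a.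

Let edge_ge0 n : 0 <= edge n.
Proof. by rewrite divr_ge0 ?(ltW a_gt0)// subr_ge0 invf_le1// ler1n. Qed.

Let edge_le (n m : nat) : (n <= m)%N -> edge n <= edge m.
Proof.
move=> nm; rewrite ler_wpM2r ?invr_ge0 ?(ltW a_gt0)// lerD2l lerN2.
by rewrite lef_pV2 ?posrE// ler_nat.
Qed.

Let edge_a n : edge n * a < 1.
Proof. by rewrite divfK ?gt_eqF// gtrBl invr_gt0. Qed.

Let edge_cvg : edge n @[n --> \oo] --> a^-1.
Proof.
rewrite -[a^-1]mul1r -[X in X / a]subr0; apply: cvgMl.
by apply: cvgB; [exact: cvg_cst|exact: cvg_harmonic].
Qed.

Let edge_den_cvg v : (1 - (edge n * v) ^+ 2) @[n --> \oo] --> 1 - (a^-1 * v) ^+ 2.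
Proof.
apply: cvgB; first exact: cvg_cst.
by rewrite expr2; apply: cvgM; apply: cvgMl; exact: edge_cvg.
Qed.

Let edge_integrand_cvg v : osym_itv a v ->
  (f v / (1 - (edge n * v) ^+ 2)) @[n --> \oo] --> f v / (1 - (a^-1 * v) ^+ 2).
Proof.
move=> Ov; apply: cvgMr; apply: cvgV; last exact: edge_den_cvg.
rewrite gt_eqF// subr_gt0 osym_sqr_lt1 ?invr_ge0 ?mulVf ?gt_eqF// ltW//.
Qed.

(** Monotone convergence: the integral does not jump at s = 1 / a, whether it
    is finite there or not. *)
Lemma resolvent_edge_sup (t : \bar R) : (t < resolvent a f a^-1)%E ->
  exists s, [/\ 0 <= s, s * a < 1 & (t < resolvent a f s)%E].
Proof.
have JE : (resolvent a f (edge n) @[n --> \oo] --> resolvent a f a^-1)%E.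
  rewrite [X in _ --> X](_ : _ = \int[mu]_(v in osym_itv a)
      limn (fun n => (f v / (1 - (edge n * v) ^+ 2))%:E))%E; last first.
    apply: eq_integral => v /set_mem Ov; apply/esym/cvg_lim => //.
    by apply: cvg_EFin; [near=> n|exact: edge_integrand_cvg].
  apply: cvg_monotone_convergence => //.
  - by move=> n; exact: mres.
  - by move=> n v Ov; rewrite lee_fin resolvent_integrand_ge0// ltW.
  move=> v Ov n m nm; have Oa (k : nat) := osym_sqr_lt1 (edge_ge0 k) (ltW (edge_a k)) Ov.
  rewrite lee_fin ler_wpM2l// lef_pV2 ?posrE ?subr_gt0// lerD2l lerN2.
  rewrite [leLHS]exprMn [leRHS]exprMn ler_wpM2r ?sqr_ge0//.
  by rewrite ler_sqr ?nnegrE ?edge_ge0// edge_le.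
move=> tJ; have [n] : exists n, (t < resolvent a f (edge n))%E.
  apply: contrapT => /forallNP H.
  suff : (resolvent a f a^-1 <= t)%E by rewrite leNgt tJ.
  by apply: (cvge_to_le JE); near=> n; rewrite leNgt; apply/negP/H.
by exists (edge n); split.
Unshelve. all: by end_near. Qed.

(** Dominated convergence: (1 - s^2 a^2) / (1 - s^2 v^2) is at most 1 and tends
    to 0 for every |v| < a. *)
Lemma resolvent_edge_small e : 0 < e ->
  exists s, [/\ 0 < s, s * a < 1 &
    ((1 - (s * a) ^+ 2)%:E * resolvent a f s < e%:E)%E].
Proof.
move=> e0.
pose g n v := ((1 - (edge n * a) ^+ 2) * (f v / (1 - (edge n * v) ^+ 2)))%:E.
have X0 n : 0 <= 1 - (edge n * a) ^+ 2.
  by rewrite subr_ge0 expr_le1 ?(ltW (edge_a n))// mulr_ge0// ltW.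
have gE n : (\int[mu]_(v in osym_itv a) g n v =
    (1 - (edge n * a) ^+ 2)%:E * resolvent a f (edge n))%E.
  rewrite -ge0_integralZl ?lee_fin//; first exact: mres.
  by move=> v Ov; rewrite lee_fin resolvent_integrand_ge0// ltW.
have if_ : mu.-integrable (osym_itv a) (fun v => (f v)%:E).
  apply/integrableP; split; first exact: mfE.
  under eq_integral do rewrite gee0_abs ?lee_fin//.
  by rewrite mass1 ltry.
have mg n : measurable_fun (osym_itv a) (g n).
  apply/measurable_EFinP; apply: measurable_funM => //.
  by apply/measurable_EFinP; exact: mres.
have g_cvg0 : {ae mu, forall v, osym_itv a v ->
    g n v @[n --> \oo] --> cst (0%:E : \bar R) v}.
  apply: aeW => v Ov; apply: cvg_EFin; first by near=> n.
  rewrite -[X in _ --> X](mul0r (f v / (1 - (a^-1 * v) ^+ 2))).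
  apply: cvgM; last exact: edge_integrand_cvg.
  by have := @edge_den_cvg a; rewrite mulVf ?gt_eqF// expr1n subrr.
have g_le : {ae mu, forall v n, osym_itv a v -> (`|g n v| <= (f v)%:E)%E}.
  apply: aeW => v n Ov.
  have y1 := osym_sqr_lt1 (edge_ge0 n) (ltW (edge_a n)) Ov.
  have yY := osym_sqr_le (edge n) Ov.
  have w_ge0 := resolvent_integrand_ge0 (edge_ge0 n) (ltW (edge_a n)) Ov.
  rewrite /g gee0_abs; last by rewrite lee_fin mulr_ge0.
  by rewrite lee_fin mulrCA ler_piMr// ler_pdivrMr ?subr_gt0// mul1r lerD2l lerN2.
have [_ _] := dominated_convergence (mu := mu) mO mg
  (measurable_cst (0%:E : \bar R)) g_cvg0 if_ g_le.
rewrite integral0 => H.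
have [n n0 Hn] : exists2 n, (0 < n)%N & (\int[mu]_(v in osym_itv a) g n v < e%:E)%E.
  apply: contrapT => Hn.
  suff : (e%:E <= 0)%E by rewrite lee_fin leNgt e0.
  apply: (cvge_to_ge H); near=> n; rewrite leNgt; apply/negP => gn.
  by apply: Hn; exists n => //; near: n; exists 1%N.
exists (edge n); rewrite -gE; split => //.
by rewrite divr_gt0// subr_gt0 invf_lt1// ltr1n.
Unshelve. all: by end_near. Qed.

End Resolvent.

(** * The reciprocal of the resolvent integral *)

(** Equal to 0 where the integral is infinite, because [fine +oo = 0] and
    [0^-1 = 0]; this is the value that makes it continuous up to s = 1 / a. *)
Definition inv_resolvent (R : realType) (a : R) (f : R -> R) (s : R) : R :=
  (fine (resolvent a f s))^-1.

(** The solution c of (1 + r) (1 - s c) J(s) = 1. *)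
Definition branch_speed (R : realType) (r a : R) (f : R -> R) (s : R) : R :=
  (1 - (1 + r)^-1 * inv_resolvent a f s) / s.

Section Branch.
Context {R : realType} {a : R} {f : R -> R} (hf : profile a f).
Implicit Types (s t : R).
Local Notation J := (resolvent a f).
Local Notation K := (inv_resolvent a f).

Let a_gt0 : 0 < a. Proof. by case: hf. Qed.

Lemma inv_resolvent_fin s : 0 <= s -> s * a <= 1 -> (J s < +oo)%E ->
  [/\ J s = (fine (J s))%:E, 1 <= fine (J s) & K s * fine (J s) = 1].
Proof.
move=> s0 sa Jy; have J1 := resolvent_ge1 hf s0 sa.
have Jfin : J s \is a fin_num by rewrite ge0_fin_numE// (le_trans _ J1).
have j1 : 1 <= fine (J s) by rewrite -lee_fin fineK.
by split => //; [rewrite fineK|rewrite mulVf// gt_eqF// (lt_le_trans _ j1)].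
Qed.

Lemma inv_resolvent_infty s : J s = +oo%E -> K s = 0.
Proof. by rewrite /inv_resolvent => ->; rewrite invr0. Qed.

Let J_case s : 0 <= s -> s * a <= 1 -> (J s = +oo%E) \/ (J s < +oo)%E.
Proof.
move=> s0 sa; have [|] := ltP (J s) +oo%E; first by right.
by rewrite leye_eq => /eqP; left.
Qed.

Lemma inv_resolvent_ge0 s : 0 <= s -> s * a <= 1 -> 0 <= K s.
Proof.
by move=> s0 sa; rewrite invr_ge0 fine_ge0// resolvent_ge0.
Qed.

Lemma inv_resolvent_gt0 s : 0 <= s -> s * a < 1 -> 0 < K s.
Proof.
move=> s0 sa; rewrite invr_gt0.
have [_ j1 _] := inv_resolvent_fin s0 (ltW sa) (resolvent_lty hf s0 sa).
exact: lt_le_trans j1.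
Qed.

Lemma inv_resolvent_le1 s : 0 <= s -> s * a <= 1 -> K s <= 1.
Proof.
move=> s0 sa; have [/inv_resolvent_infty->//|Jy] := J_case s0 sa.
have [_ j1 _] := inv_resolvent_fin s0 sa Jy.
by rewrite invf_le1// (lt_le_trans _ j1).
Qed.

Lemma le_inv_resolvent s t : 0 <= s -> s <= t -> t * a <= 1 -> K t <= K s.
Proof.
move=> s0 st ta; have t0 := le_trans s0 st.
have sa : s * a <= 1 by rewrite (le_trans _ ta)// ler_pM2r.
have [/inv_resolvent_infty->|Jt] := J_case t0 ta; first exact: inv_resolvent_ge0.
have Jst := le_resolvent hf s0 st ta.
have [Et jt _] := inv_resolvent_fin t0 ta Jt.
have [Es js _] := inv_resolvent_fin s0 sa (le_lt_trans Jst Jt).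
rewrite lef_pV2 ?posrE ?(lt_le_trans _ jt) ?(lt_le_trans _ js)//.
by rewrite -lee_fin -Es -Et.
Qed.

Lemma inv_resolvent_ratio s t : 0 <= s -> s <= t -> t * a <= 1 ->
  K s * (1 - (t * a) ^+ 2) <= K t * (1 - (s * a) ^+ 2).
Proof.
move=> s0 st ta; have t0 := le_trans s0 st.
have sa : s * a <= 1 by rewrite (le_trans _ ta)// ler_pM2r.
have X0 : 0 <= 1 - (s * a) ^+ 2 by rewrite subr_ge0 expr_le1// mulr_ge0// ltW.
have [/inv_resolvent_infty->|Js] := J_case s0 sa.
  by rewrite mul0r mulr_ge0// inv_resolvent_ge0.
have [ta1|ta1] := eqVneq (t * a) 1.
  by rewrite ta1 expr1n subrr mulr0 mulr_ge0// inv_resolvent_ge0.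
have {}ta1 : t * a < 1 by rewrite lt_neqAle ta1.
have [Es js KJs] := inv_resolvent_fin s0 sa Js.
have [Et jt KJt] := inv_resolvent_fin t0 ta (resolvent_lty hf t0 ta1).
have := resolvent_ratio hf s0 st ta; rewrite Es Et -!EFinM lee_fin => H.
have KK : 0 <= K s * K t by rewrite mulr_ge0// inv_resolvent_ge0.
have := ler_wpM2l KK H.
have -> : K s * K t * ((1 - (t * a) ^+ 2) * fine (J t)) =
  K s * (1 - (t * a) ^+ 2) * (K t * fine (J t)) by ring.
have -> : K s * K t * ((1 - (s * a) ^+ 2) * fine (J s)) =
  K t * (1 - (s * a) ^+ 2) * (K s * fine (J s)) by ring.
by rewrite KJs KJt !mulr1.
Qed.

Lemma inv_resolvent_ge_edge s : 0 <= s -> s * a <= 1 -> 1 - (s * a) ^+ 2 <= K s.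
Proof.
move=> s0 sa; have := inv_resolvent_ratio (lexx 0) s0 sa.
rewrite mul0r expr0n subr0 mulr1; apply: le_trans.
by rewrite /inv_resolvent (resolvent0 hf)/= invr1 mul1r.
Qed.

(** [resolvent_ge_tangent] at k = J(s). *)
Lemma inv_resolvent_le_variance D s :
  (\int[mu]_(v in osym_itv a) (v ^+ 2 * f v)%:E = D%:E)%E ->
  s ^+ 2 * D <= 1 -> 0 <= s -> s * a <= 1 -> K s <= 1 - s ^+ 2 * D.
Proof.
move=> hD sD s0 sa.
have [/inv_resolvent_infty->|Js] := J_case s0 sa; first by rewrite subr_ge0.
have [Es js KJs] := inv_resolvent_fin s0 sa Js.
have j0 : 0 < fine (J s) by exact: lt_le_trans js.
have := resolvent_ge_tangent hf hD s0 sa (ltW j0); rewrite Es -EFinD lee_fin => H.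
rewrite -[leLHS]mul1r ler_pdivrMr//.
rewrite -(ler_pM2l j0); lra.
Qed.

Lemma inv_resolvent_ge_variance D s :
  (\int[mu]_(v in osym_itv a) (v ^+ 2 * f v)%:E = D%:E)%E ->
  0 <= s -> s * a < 1 -> 1 - s ^+ 2 * D / (1 - (s * a) ^+ 2) <= K s.
Proof.
move=> hD s0 sa.
have Js := resolvent_lty hf s0 sa.
have [Es js KJs] := inv_resolvent_fin s0 (ltW sa) Js.
have := resolvent_le_variance hf hD s0 sa; rewrite Es lee_fin => H.
have j0 : 0 < fine (J s) by exact: lt_le_trans js.
rewrite -[leRHS]mul1r ler_pdivlMr//.
set x := s ^+ 2 * D / _ in H *; set j := fine _ in js H j0 *.
nra.
Qed.

Lemma inv_resolvent_edge_inf e : 0 < e ->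
  exists s, [/\ 0 <= s, s * a < 1 & K s < K a^-1 + e].
Proof.
move=> e0; have ai0 : 0 <= a^-1 by rewrite invr_ge0 ltW.
have aia : a^-1 * a <= 1 by rewrite mulVf// gt_eqF.
have K0 := inv_resolvent_ge0 ai0 aia.
have Ke : 0 < K a^-1 + e by exact: ltr_wpDl.
have [|s [s0 sa Hs]] := @resolvent_edge_sup R a f hf ((K a^-1 + e)^-1)%:E.
  have [->|Jy] := J_case ai0 aia; first exact: ltry.
  have [E j1 KJ] := inv_resolvent_fin ai0 aia Jy.
  rewrite E lte_fin invf_plt ?posrE//; last exact: lt_le_trans j1.
  by rewrite /inv_resolvent ltrDl.
exists s; split => //.
have [E j1 KJ] := inv_resolvent_fin s0 (ltW sa) (resolvent_lty hf s0 sa).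
move: Hs; rewrite E lte_fin => Hs.
by rewrite /inv_resolvent invf_plt ?posrE// (lt_le_trans _ j1).
Qed.

Lemma inv_resolvent_edge_gt e : 0 < e ->
  exists s, [/\ 0 < s, s * a < 1 & 1 - (s * a) ^+ 2 < e * K s].
Proof.
move=> e0; have [s [s0 sa]] := resolvent_edge_small hf e0.
have [E j1 KJ] := inv_resolvent_fin (ltW s0) (ltW sa) (resolvent_lty hf (ltW s0) sa).
rewrite E -EFinM lte_fin => H; exists s; split => //.
by rewrite /inv_resolvent ltr_pdivlMr// (lt_le_trans _ j1).
Qed.

(** For t near s the two monotonicities enclose K t between K s and
    K s (1 - t^2 a^2) / (1 - s^2 a^2). *)
Lemma inv_resolvent_continuous s : 0 < s -> s * a < 1 -> {for s, continuous K}.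
Proof.
move=> s0 sa.
have X0 : 0 < 1 - (s * a) ^+ 2.
  by rewrite subr_gt0 expr_lt1 ?mulr_ge0// ltW.
pose bnd t := K s / (1 - (s * a) ^+ 2) * `|(s * a) ^+ 2 - (t * a) ^+ 2|.
have bnd_cvg : bnd t @[t --> s] --> 0.
  rewrite (_ : 0 = bnd s); last by rewrite /bnd subrr normr0 mulr0.
  apply: cvgMr; apply: cvg_norm; apply: cvgB; first exact: cvg_cst.
  by rewrite expr2; apply: cvgM; apply: cvgMl; exact: cvg_id.
have dist_bnd : \forall t \near s, K s - bnd t <= K t <= K s + bnd t.
  have ltai : s < a^-1 by rewrite -[a^-1]mul1r ltr_pdivlMr.
  near=> t.
  have t0 : 0 < t by near: t; exact: lt_nbhsr.
  have ta : t * a < 1.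
    by rewrite -ltr_pdivlMr// mul1r; near: t; exact: lt_nbhsl.
  have bndE : bnd t * (1 - (s * a) ^+ 2) = K s * `|(s * a) ^+ 2 - (t * a) ^+ 2|.
    by rewrite /bnd mulrAC divfK ?gt_eqF.
  have b0 : 0 <= bnd t.
    by rewrite mulr_ge0// divr_ge0 ?(ltW X0)// inv_resolvent_ge0// ltW.
  have sq u w : 0 <= u -> u <= w -> (u * a) ^+ 2 <= (w * a) ^+ 2.
    move=> u0 uw; rewrite ler_sqr ?nnegrE ?ler_pM2r// mulr_ge0 ?(ltW a_gt0)//.
    exact: le_trans uw.
  have [st|/ltW ts] := leP s t.
  - have Kst := le_inv_resolvent (ltW s0) st (ltW ta).
    have H := inv_resolvent_ratio (ltW s0) st (ltW ta).
    move: bndE; rewrite ler0_norm ?subr_le0 ?sq // ?(ltW s0) ?(ltW t0) // => bndE.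
    apply/andP; split; last by lra.
    by rewrite -(ler_pM2r X0); lra.
  - have Kst := le_inv_resolvent (ltW t0) ts (ltW sa).
    have H := inv_resolvent_ratio (ltW t0) ts (ltW sa).
    move: bndE; rewrite ger0_norm ?subr_ge0 ?sq // ?(ltW s0) ?(ltW t0) // => bndE.
    apply/andP; split; first by lra.
    by rewrite -(ler_pM2r X0); lra.
apply: (squeeze_cvgr dist_bnd).
- by rewrite -[X in _ --> X]subr0; apply: cvgB => //; exact: cvg_cst.
- by rewrite -[X in _ --> X]addr0; apply: cvgD => //; exact: cvg_cst.
Unshelve. all: by end_near. Qed.

Lemma inv_resolvent_left_continuous : K s @[s --> a^-1^'-] --> K a^-1.
Proof.
have aia : a^-1 * a <= 1 by rewrite mulVf// gt_eqF.
apply/cvgrPdist_le => e e0.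
have [s [s0 sa Hs]] := inv_resolvent_edge_inf e0.
have sai : s < a^-1 by rewrite -[a^-1]mul1r ltr_pdivlMr.
near=> t.
have st : s <= t by near: t; exact: nbhs_left_ge.
have ta : t * a <= 1.
  by rewrite -ler_pdivlMr// mul1r ltW//; near: t; exact: nbhs_left_lt.
have tai : t <= a^-1 by rewrite -[a^-1]mul1r ler_pdivlMr.
have K1 := le_inv_resolvent s0 st ta.
have K2 := le_inv_resolvent (le_trans s0 st) tai aia.
by rewrite distrC ger0_norm ?subr_ge0//; lra.
Unshelve. all: by end_near. Qed.

(** * The slowest branch point *)

Section Minimum.
Context {r : R} (r_gt0 : 0 < r).
Local Notation cs := (branch_speed r a f).

Let ir_gt0 : 0 < (1 + r)^-1. Proof. by rewrite invr_gt0 addr_gt0. Qed.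

(** C(s) < a amounts to (1 + r) (1 - s a) J(s) < 1, which holds close to the
    edge by [resolvent_edge_small]. *)
Lemma branch_speed_lt_edge : exists s, [/\ 0 < s, s * a < 1 & cs s < a].
Proof.
have e0 : 0 < (1 + r)^-1 / 2 by rewrite divr_gt0.
have [s [s0 sa H]] := inv_resolvent_edge_gt e0; exists s; split => //.
have K0 := inv_resolvent_gt0 (ltW s0) sa.
rewrite /branch_speed ltr_pdivrMr// [ltRHS]mulrC.
set x := s * a in sa H *; set y := (1 + r)^-1 * K s.
have xy : 1 - x ^+ 2 < y / 2 by rewrite /y -mulrAC.
have x0 : 0 < x by rewrite mulr_gt0.
have y0 : 0 < y by rewrite mulr_gt0.
nra.
Qed.

Lemma branch_speed_ge s : 0 < s -> s * a <= 1 -> r / (1 + r) / s <= cs s.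
Proof.
move=> s0 sa; rewrite ler_pM2r ?invr_gt0//.
have -> : r / (1 + r) = 1 - (1 + r)^-1 * 1 by field; rewrite gt_eqF// addr_gt0.
by rewrite lerD2l lerN2 ler_pM2l// inv_resolvent_le1// ltW.
Qed.

Lemma branch_speed_continuous_edge d : 0 < d -> d < a^-1 ->
  {within `[d, a^-1], continuous cs}.
Proof.
move=> d0 da; apply/continuous_within_itvP => //.
have cvgs s (F : set_system R) : Filter F -> 0 < s ->
    K x @[x --> F] --> K s -> x @[x --> F] --> s -> cs x @[x --> F] --> cs s.
  move=> FF s0 Ks idF; apply: cvgM; last by apply: cvgV => //; rewrite gt_eqF.
  by apply: cvgB; [exact: cvg_cst|apply: cvgMr].
have sas s : s < a^-1 -> s * a < 1 by rewrite -[a^-1]mul1r ltr_pdivlMr.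
split.
- move=> s; rewrite in_itv/= => /andP[ds /sas sa].
  have s0 : 0 < s := lt_trans d0 ds.
  by apply: cvgs => //; exact: inv_resolvent_continuous.
- apply: cvgs => //.
    by apply: cvg_at_right_filter; apply: inv_resolvent_continuous => //; exact: sas.
  by apply: cvg_at_right_filter; exact: cvg_id.
- apply: cvgs; first by rewrite invr_gt0.
    exact: inv_resolvent_left_continuous.
  by apply: cvg_at_left_filter; exact: cvg_id.
Qed.

(** By [branch_speed_ge], C(s) >= a for s <= d = r / ((1 + r) a), so the minimum
    over the compact interval [d, 1 / a] is a minimum over ]0, 1 / a]. *)
Lemma branch_speed_min : exists s0, [/\ 0 < s0, s0 * a <= 1, cs s0 < a &
  forall s, 0 < s -> s * a <= 1 -> cs s0 <= cs s].
Proof.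
have [s1 [s1_gt0 s1a cs1]] := branch_speed_lt_edge.
pose d := r / (1 + r) / a.
have d0 : 0 < d by rewrite !divr_gt0// addr_gt0.
have da : d < a^-1.
  by rewrite -[ltRHS]mul1r ltr_pM2r ?invr_gt0// ltr_pdivrMr ?addr_gt0//; lra.
have cs_small s : 0 < s -> s * a <= 1 -> s <= d -> a <= cs s.
  move=> s0 sa sd; apply: le_trans (branch_speed_ge s0 sa).
  by rewrite ler_pdivlMr// mulrC -ler_pdivlMr.
have ds1 : d < s1.
  by rewrite ltNge; apply/negP => /(cs_small _ s1_gt0 (ltW s1a)); rewrite leNgt cs1.
have [s0 s0I s0min] := EVT_min (ltW da) (branch_speed_continuous_edge d0 da).
have leai s : (s <= a^-1) = (s * a <= 1) by rewrite -[a^-1]mul1r ler_pdivlMr.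
have cs01 : cs s0 <= cs s1.
  by apply: s0min; rewrite in_itv/= leai !ltW.
move: s0I; rewrite in_itv/= leai => /andP[ds0 s0a].
exists s0; split => //.
- exact: lt_le_trans ds0.
- exact: le_lt_trans cs1.
move=> s sgt0 sa; have [sd|ds] := leP s d.
  by rewrite (le_trans cs01)// (le_trans (ltW cs1))// cs_small.
by apply: s0min; rewrite in_itv/= leai sa ltW.
Qed.

End Minimum.

(** * The dispersion relation *)

(** The average of 1 / (1 - s v) and 1 / (1 + s v) is 1 / (1 - s^2 v^2). *)
Lemma resolvent_reflect s : 0 <= s -> s * a <= 1 ->
  (\int[mu]_(v in osym_itv a) (f v / (1 - s * v))%:E = J s)%E.
Proof.
move=> s0 sa; case: hf => _ mf f0 fN _.
have mO : measurable (osym_itv a) by exact: measurable_itv.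
have den v : osym_itv a v -> 0 < 1 - s * v /\ 0 < 1 + s * v.
  by move=> Ov; have := osym_sqr_lt1 hf s0 sa Ov; split; nra.
have mden (k : R) : measurable_fun (osym_itv a) (fun v => (f v / (1 - k * v))%:E).
  apply/measurable_EFinP; apply: measurable_funTS; apply: measurable_funM => //.
  apply: measurableT_comp; first exact: measurable_inv.
  by apply: measurable_funB; [exact: measurable_cst|exact: mulrl_measurable].
have g0 v : osym_itv a v -> (0 <= (f v / (1 - s * v))%:E)%E.
  by move=> /den[d1 _]; rewrite lee_fin divr_ge0// ltW.
have g0' v : osym_itv a v -> (0 <= (f v / (1 - - s * v))%:E)%E.
  by move=> /den[_ d2]; rewrite lee_fin divr_ge0// mulNr opprK ltW.
set A := (LHS).
have A' : A = (\int[mu]_(v in osym_itv a) (f v / (1 - - s * v))%:E)%E.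
  rewrite /A ge0_integral_reflect//; apply: eq_integral => v _.
  by rewrite fN mulrN mulNr.
have A0 : (0 <= A)%E by exact: integral_ge0.
have h0 : (0 <= (2^-1 : R)%:E)%E by rewrite lee_fin.
have -> : J s = ((2^-1 : R)%:E * A + (2^-1 : R)%:E * A)%E.
  rewrite {2}A' /A -[X in (X + _)%E]ge0_integralZl//; last exact: mden.
  rewrite -[X in (_ + X)%E]ge0_integralZl//; last exact: mden.
  rewrite -ge0_integralD//; first last.
  - by apply: emeasurable_funM; [exact: measurable_cst|exact: mden].
  - by move=> v Ov; rewrite mule_ge0// g0'.
  - by apply: emeasurable_funM; [exact: measurable_cst|exact: mden].
  - by move=> v Ov; rewrite mule_ge0// g0.
  apply: eq_integral => v /set_mem/den[d1 d2]; rewrite -!EFinM -EFinD; congr EFin.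
  have d3 : 1 - (s * v) ^+ 2 != 0.
    by rewrite gt_eqF// (_ : _ - _ = (1 - s * v) * (1 + s * v)) ?mulr_gt0//; ring.
  rewrite mulNr opprK; set y := s * v in d1 d2 d3 *.
  by field; rewrite d3 !gt_eqF.
rewrite -ge0_muleDl// -EFinD (_ : (2^-1 + 2^-1 : R) = 1) ?mul1e//.
by field.
Qed.

(** The change of unknown s = lambda / (1 + lambda c) separates c from the
    integral. *)
Lemma dispersion_factorization lambda c :
  0 <= c < a -> 0 < lambda <= (a - c)^-1 ->
  let s := lambda / (1 + lambda * c) in
  [/\ 0 < s, s * a <= 1, s * c < 1 &
  (\int[mu]_(v in osym_itv a) (f v / (1 + lambda * (c - v)))%:E =
   (1 - s * c)%:E * J s)%E].
Proof.
move=> /andP[c0 ca] /andP[l0 la] s.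
have ac : 0 < a - c by rewrite subr_gt0.
have {}la : lambda * (a - c) <= 1 by rewrite -ler_pdivlMr// mul1r.
have A0 : 0 < 1 + lambda * c by rewrite ltr_wpDr// mulr_ge0// ltW.
have sA : s * (1 + lambda * c) = lambda by rewrite /s divfK// gt_eqF.
have s0 : 0 < s by rewrite divr_gt0.
have sa : s * a <= 1 by rewrite /s mulrAC ler_pdivrMr// mul1r; lra.
have sc : s * c < 1 by rewrite /s mulrAC ltr_pdivrMr// mul1r; lra.
split => //; rewrite -resolvent_reflect ?(ltW s0)//.
have scA : (1 - s * c) * (1 + lambda * c) = 1.
  by rewrite /s; field; rewrite gt_eqF.
case: hf => _ mf f0 _ _.
have mO : measurable (osym_itv a) by exact: measurable_itv.
rewrite -ge0_integralZl ?lee_fin ?subr_ge0 ?(ltW sc)//; last 2 first.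
- apply/measurable_EFinP; apply: measurable_funTS; apply: measurable_funM => //.
  apply: measurableT_comp; first exact: measurable_inv.
  by apply: measurable_funB; [exact: measurable_cst|exact: mulrl_measurable].
- move=> v Ov; rewrite lee_fin divr_ge0// ltW//.
  by have := osym_sqr_lt1 hf (ltW s0) sa Ov; nra.
apply: eq_integral => v /set_mem Ov; rewrite -EFinM; congr EFin.
have dv : 0 < 1 - s * v by have := osym_sqr_lt1 hf (ltW s0) sa Ov; nra.
have -> : 1 + lambda * (c - v) = (1 + lambda * c) * (1 - s * v).
  by rewrite [RHS]mulrBr mulr1 [in RHS]mulrA [in RHS](mulrC _ s) sA; ring.
have -> : 1 - s * c = (1 + lambda * c)^-1.
  by apply: (@mulIf _ (1 + lambda * c)); rewrite ?scA ?mulVf// gt_eqF.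
by rewrite invfM mulrCA.
Qed.

(** The velocity set enters only through its supremum and through the
    integrals against the dispersion kernel, which allows V itself as well as
    [-a, a].  At a minimizer C(s0) < a <= 1 / s0, so J(s0) is finite and the
    dispersion relation can be recovered. *)
Lemma branch_minimal_speed (r : R) (W : set R) (g : R -> R) s0 : 0 < r ->
  sup W = a ->
  (forall lambda c : R, 0 <= c < a -> 0 < lambda <= (a - c)^-1 -> (
    \int[mu]_(v in W) (g v / (1 + lambda * (c - v)))%:E =
    \int[mu]_(v in osym_itv a) (f v / (1 + lambda * (c - v)))%:E)%E) ->
  0 < s0 -> s0 * a <= 1 -> branch_speed r a f s0 < a ->
  (forall s, 0 < s -> s * a <= 1 -> branch_speed r a f s0 <= branch_speed r a f s) ->
  is_minimal_speed r W g (branch_speed r a f s0).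
Proof.
move=> r0 supW gf s0_gt0 s0a cs0 csmin.
have r1 : 0 < 1 + r by rewrite addr_gt0.
have r1e : 1 + r != 0 by rewrite gt_eqF.
split; last first.
  move=> c []; rewrite supW => ca [lambda [la]].
  rewrite /dispI gf//; set s := lambda / (1 + lambda * c).
  have [sgt0 sa sc ->] := dispersion_factorization ca la => I1.
  suff -> : c = branch_speed r a f s by exact: csmin.
  have [Jy|Jy] := J_case (ltW sgt0) sa.
    move: I1; rewrite Jy mulry gtr0_sg ?subr_gt0// mul1e mulry gtr0_sg// mul1e.
    by [].
  have [E j1 KJ] := inv_resolvent_fin (ltW sgt0) sa Jy.
  move: I1; rewrite E -!EFinM => /eqP; rewrite eqe => /eqP I1.
  have KE : K s = (1 + r) * (1 - s * c).
    have j0 : fine (J s) != 0 by rewrite gt_eqF// (lt_le_trans _ j1).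
    by apply: (mulIf j0); rewrite KJ -mulrA.
  rewrite /branch_speed KE; field; rewrite gt_eqF//=.
have c0 : 0 <= branch_speed r a f s0.
  apply: le_trans (branch_speed_ge r0 s0_gt0 s0a).
  by rewrite !divr_ge0// ltW.
set c := branch_speed r a f s0 in c0 cs0 *.
have ca : 0 <= c < a by rewrite c0.
split; first by rewrite supW.
have s0c : s0 * c < 1.
  by apply: lt_le_trans s0a; rewrite ltr_pM2l.
have KE : K s0 = (1 + r) * (1 - s0 * c).
  by rewrite /c /branch_speed; field; rewrite gt_eqF.
have K0 : 0 < K s0 by rewrite KE mulr_gt0// subr_gt0.
pose lambda := s0 / (1 - s0 * c).
have la : 0 < lambda <= (a - c)^-1.
  rewrite /lambda divr_gt0 ?subr_gt0//= ler_pdivrMr ?subr_gt0//.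
  by rewrite mulrC ler_pdivlMr ?subr_gt0// mulrBr lerD2r.
exists lambda; split; first by rewrite supW.
rewrite /dispI gf//.
have [] := dispersion_factorization ca la.
have -> : lambda / (1 + lambda * c) = s0.
  rewrite /lambda; field; rewrite subrK oner_eq0 gt_eqF// subr_gt0//.
move=> _ _ _ ->.
have [/inv_resolvent_infty K00|Jy] := J_case (ltW s0_gt0) s0a.
  by move: K0; rewrite K00 ltxx.
have [-> j1 KJ] := inv_resolvent_fin (ltW s0_gt0) s0a Jy.
by rewrite -!EFinM mulrA -KE KJ.
Qed.

End Branch.

(** * A rearrangement inequality *)

Section Bathtub.
Context {d : measure_display} {T : measurableType d} {R : realType}
  {m : {measure set T -> \bar R}}.
Implicit Types (A B : set T) (w : T -> R).

Lemma measure_setD_eq A B : measurable A -> measurable B ->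
  (m A < +oo)%E -> m A = m B -> m (A `\` B) = m (B `\` A).
Proof.
move=> mA mB Ay AB; have By : (m B < +oo)%E by rewrite -AB.
by rewrite !measureD// setIC; congr (_ - _)%E.
Qed.

(** The sets A \ B and B \ A have the same measure, and the infimum of w over
    the latter separates the values of w on the two sets. *)
Lemma bathtub A B w : measurable A -> measurable B ->
  (m A < +oo)%E -> m A = m B ->
  measurable_fun (A `|` B) w -> (forall x, (A `|` B) x -> 0 <= w x) ->
  (forall x y, (A `\` B) x -> (B `\` A) y -> w x <= w y) ->
  (\int[m]_(x in A) (w x)%:E <= \int[m]_(x in B) (w x)%:E)%E.
Proof.
move=> mA mB Ay AB mw w0 wle.
have mAB : measurable (A `\` B) by exact: measurableD.
have mBA : measurable (B `\` A) by exact: measurableD.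
have mI : measurable (A `&` B) by exact: measurableI.
have split_ X Y : measurable X -> measurable Y -> X `|` Y = A `|` B ->
    (\int[m]_(x in X) (w x)%:E =
     \int[m]_(x in X `&` Y) (w x)%:E + \int[m]_(x in X `\` Y) (w x)%:E)%E.
  move=> mX mY XY; have XE : X = (X `&` Y) `|` (X `\` Y) by rewrite setUIDK.
  have sub : X `<=` A `|` B by rewrite -XY; exact: subsetUl.
  rewrite {1}XE ge0_integral_setU//.
  - exact: measurableI.
  - exact: measurableD.
  - apply/measurable_EFinP; rewrite -XE.
    by apply: measurable_funS mw => //; exact: measurableU.
  - by rewrite -XE => x Xx; rewrite lee_fin w0//; exact: sub.
  - by rewrite disj_set2E; apply/eqP/seteqP; split => // x [[_ Yx] [_ /(_ Yx)]].
rewrite (split_ A B)// (split_ B A)// 1?setUC// [B `&` A]setIC leeD2l//.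
have mE := measure_setD_eq mA mB Ay AB.
have mwAB : measurable_fun (A `\` B) (fun x => (w x)%:E).
  apply/measurable_EFinP; apply: measurable_funS mw; first exact: measurableU.
  by move=> x []; left.
have mwBA : measurable_fun (B `\` A) (fun x => (w x)%:E).
  apply/measurable_EFinP; apply: measurable_funS mw; first exact: measurableU.
  by move=> x []; right.
have [BA0|/set0P[y0 y0BA]] := eqVneq (B `\` A) set0.
  have AB0 : m (A `\` B) = 0%E by rewrite mE BA0 measure0.
  by rewrite (null_set_integral mAB mwAB AB0) BA0 integral_set0.
have w_lb : has_lbound (w @` (B `\` A)).
  by exists 0 => _ [y [By _] <-]; apply: w0; right.
pose k := inf (w @` (B `\` A)).
have wk x : (A `\` B) x -> w x <= k.
  move=> ABx; apply: lb_le_inf; first by exists (w y0), y0.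
  by move=> _ [y BAy <-]; exact: wle.
have kw y : (B `\` A) y -> k <= w y by move=> BAy; apply: ge_inf => //; exists y.
have k0 : 0 <= k.
  apply: lb_le_inf; first by exists (w y0), y0.
  by move=> _ [y [By _] <-]; apply: w0; right.
apply: (@le_trans _ _ (k%:E * m (A `\` B))%E).
  rewrite -integral_cst//; apply: ge0_le_integral => // x ABx.
  by rewrite lee_fin w0//; left; case: ABx.
rewrite mE -integral_cst//; exact: ge0_le_integral.
Qed.

End Bathtub.
Definition superlevel (R : realType) (f : R -> R) (t : R) : set R :=
  [set v | t < f v].

Section LayerCake.
Context {R : realType}.
Implicit Types (f g w : R -> R) (E : set R).

(** The region between 0 and the graph of f over E, weighted by w. *)
Let layer E f w (p : measurableTypeR R * measurableTypeR R) : \bar R :=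
  (w p.1 * \1_[set q : R * R | E q.1 /\ 0 <= q.2 < f q.1] p)%:E.

Let layer_ge0 E f w p : (forall x, 0 <= w x) -> (0 <= layer E f w p)%E.
Proof. by move=> w0; rewrite lee_fin mulr_ge0. Qed.

Let measurable_layer E f w : measurable E ->
  measurable_fun [set: R] f -> measurable_fun [set: R] w ->
  measurable_fun [set: measurableTypeR R * measurableTypeR R] (layer E f w).
Proof.
move=> mE mf mw; apply/measurable_EFinP; apply: measurable_funM.
  exact: measurableT_comp.
apply: measurable_indic.
pose P1 (p : measurableTypeR R * measurableTypeR R) : bool := 0 <= p.2.
pose P2 (p : measurableTypeR R * measurableTypeR R) : bool := p.2 < f p.1.
rewrite [X in measurable X](_ : _ = (fst @^-1` E) `&`
   (P1 @^-1` [set true] `&` P2 @^-1` [set true])); last first.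
  by apply/seteqP; split => -[x t]/=; [case=> Ex /andP[]|case=> Ex []] => t0 tf;
    split => //; apply/andP.
apply: measurableI; first by rewrite -[X in measurable X]setTI; exact: measurable_fst.
apply: measurableI.
- have : measurable_fun setT P1 by exact: measurable_fun_ler.
  by move=> /(_ measurableT [set true]); rewrite setTI; exact.
- have : measurable_fun setT P2.
    by apply: measurable_fun_ltr => //; exact: measurableT_comp.
  by move=> /(_ measurableT [set true]); rewrite setTI; exact.
Qed.

Let layer_slice E f w t : measurable E -> measurable_fun [set: R] f ->
  measurable_fun [set: R] w -> 0 <= t ->
  (\int[mu]_x layer E f w (x, t) =
   \int[mu]_(x in E `&` superlevel f t) (w x)%:E)%E.
Proof.
move=> mE mf mw t0; rewrite [RHS]integral_mkcond; apply: eq_integral => x _.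
rewrite /layer/= patchE indicE.
case: ifPn => [/set_mem[Ex /= tf]|/negP xn].
  by rewrite mem_set ?mulr1//=; split => //=; rewrite t0.
rewrite memNset ?mulr0//= => -[Ex /andP[_ tf]]; apply: xn; exact/mem_set.
Qed.

(** Tonelli's theorem: f x is the length of the slice [0, f x[. *)
Lemma layer_cake E f w : measurable E ->
  measurable_fun [set: R] f -> measurable_fun [set: R] w ->
  (forall x, 0 <= f x) -> (forall x, 0 <= w x) ->
  (\int[mu]_(x in E) (f x * w x)%:E =
   \int[mu]_t \int[mu]_x layer E f w (x, t))%E.
Proof.
move=> mE mf mw f0 w0.
rewrite -(fubini_tonelli (layer E f w)); last 2 first.
- exact: measurable_layer.
- by move=> p; exact: layer_ge0.
rewrite integral_mkcond; apply: eq_integral => x _.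
rewrite patchE; case: ifPn => [/set_mem Ex|/negP xE].
  transitivity (\int[mu]_t ((w x)%:E * (\1_(`[0%R, f x[) t)%:E))%E.
    have mI : measurable (`[0, f x[%classic : set R) by exact: measurable_itv.
    rewrite ge0_integralZl ?lee_fin//; last first.
      by apply/measurable_EFinP; exact: measurable_indic.
    have muI : mu (`[0, f x[%classic : set R) = (f x)%:E.
      rewrite lebesgue_measure_itv/= lte_fin.
      have [fx0|] := ltP 0 (f x); first by rewrite oppr0 adde0.
      by move=> fx0; rewrite (@le_anti _ _ (f x) 0)// fx0 f0.
    rewrite integral_indic// setIT mulrC EFinM; congr (_ * _)%E.
    exact/esym/muI.
  apply: eq_integral => t _; rewrite /layer/= -EFinM !indicE; congr (_ * _%:R)%:E.
  congr nat_of_bool; apply/idP/idP => /set_mem H; apply/mem_set => /=; move: H => /=.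
    by rewrite in_itv.
  by rewrite in_itv/= => -[].
rewrite integral0_eq// => t _; rewrite /layer/= indicE memNset ?mulr0//=.
by move=> -[Ex _]; apply: xE; exact/mem_set.
Qed.

Lemma le_integral_layers E f g w : measurable E ->
  measurable_fun [set: R] f -> measurable_fun [set: R] g ->
  measurable_fun [set: R] w -> (forall x, 0 <= f x) -> (forall x, 0 <= g x) ->
  (forall x, 0 <= w x) ->
  (forall t, 0 <= t ->
    (\int[mu]_(x in E `&` superlevel f t) (w x)%:E <=
     \int[mu]_(x in E `&` superlevel g t) (w x)%:E)%E) ->
  (\int[mu]_(x in E) (f x * w x)%:E <= \int[mu]_(x in E) (g x * w x)%:E)%E.
Proof.
move=> mE mf mg mw f0 g0 w0 fg; rewrite !layer_cake//.
have mG h : measurable_fun [set: R] h ->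
    measurable_fun [set: R] (fun t => \int[mu]_x layer E h w (x, t))%E.
  move=> mh; apply: (measurable_fun_fubini_tonelli_G (layer E h w)).
    exact: measurable_layer.
  by move=> p; exact: layer_ge0.
apply: ge0_le_integral => //; [|exact: mG..|] => t _.
  by apply: integral_ge0 => x _; exact: layer_ge0.
have [t0|t0] := leP 0 t; first by rewrite !layer_slice// fg.
rewrite !integral0_eq// => x _; rewrite /layer/= indicE memNset ?mulr0//=;
  by move=> -[_ /andP[]]; rewrite leNgt t0.
Qed.

(** Passing from f to g moves mass to where w is larger: [bathtub] compares the
    superlevel sets at each level, and [layer_cake] sums over the levels. *)
Lemma le_integral_rearrangement E f g w : measurable E -> (mu E < +oo)%E ->
  measurable_fun [set: R] f -> measurable_fun [set: R] g ->
  measurable_fun [set: R] w -> (forall x, 0 <= f x) -> (forall x, 0 <= g x) ->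
  (forall x, 0 <= w x) ->
  (forall t, 0 <= t -> mu (E `&` superlevel f t) = mu (E `&` superlevel g t)) ->
  (forall t x y, E x -> E y -> t < f x -> g x <= t -> f y <= t -> t < g y ->
    w x <= w y) ->
  (\int[mu]_(x in E) (f x * w x)%:E <= \int[mu]_(x in E) (g x * w x)%:E)%E.
Proof.
move=> mE Ey mf mg mw f0 g0 w0 fg wfg; apply: le_integral_layers => // t t0.
have mS h : measurable_fun [set: R] h -> measurable (E `&` superlevel h t).
  move=> mh; apply: measurableI => //; rewrite -[X in measurable X]setTI.
  rewrite (_ : superlevel h t = h @^-1` `]t, +oo[).
    by apply: mh => //; exact: measurable_itv.
  by apply/seteqP; split => x /=; rewrite in_itv/= andbT.
apply: bathtub; [exact: mS|exact: mS| |exact: fg| | |].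
- by apply: le_lt_trans Ey; apply: le_measure; rewrite ?inE//; exact: mS.
- exact: measurable_funTS.
- by [].
move=> x y [[Ex tfx] ngx] [[Ey' tgy] nfy]; apply: (wfg t) => //.
- by rewrite leNgt; apply/negP => tgx; apply: ngx.
- by rewrite leNgt; apply/negP => tfy; apply: nfy.
Qed.

End LayerCake.

(** * Monotone rearrangements *)

(** A version of N that is a [profile] once N is an even rearrangement of one: it
    depends on |v| only, is nonnegative and vanishes outside ]-a, a[.
    Equimeasurability forces N >= 0 only almost everywhere, whence the
    maximum. *)
Definition radial_part (R : realType) (a : R) (N : R -> R) (v : R) : R :=
  ((fun u => Num.max (N u) 0) \_ `[0, a[) `|v|.

Section Rearrangement.
Context {R : realType} {a : R} {f N : R -> R}.
Context (hf : profile a f).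
Context (N_even : forall v, sym_itv a v -> N (- v) = N v).
Context (mN : measurable_fun `[0, a[ N).
Context (Nf : equimeasurable_on (sym_itv a) N f).
Implicit Types (t v : R).

Let a_gt0 : 0 < a. Proof. by case: hf. Qed.
Let mf : measurable_fun [set: R] f. Proof. by case: hf. Qed.
Let f_ge0 v : 0 <= f v. Proof. by case: hf. Qed.
Let mO : measurable (osym_itv a). Proof. exact: measurable_itv. Qed.
Let mE : measurable (sym_itv a). Proof. exact: measurable_itv. Qed.

Let OE : osym_itv a `<=` sym_itv a.
Proof. by move=> v /osym_itvP/andP[v1 v2]; rewrite /sym_itv/= in_itv/= !ltW. Qed.

Let Ey : (mu (sym_itv a) < +oo)%E.
Proof.
by rewrite /sym_itv lebesgue_measure_itv/= lte_fin; case: ifPn => _; rewrite ltry.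
Qed.

Let Oy : (mu (osym_itv a) < +oo)%E.
Proof. by apply: le_lt_trans Ey; apply: le_measure; rewrite ?inE. Qed.

Let O_abs v : osym_itv a v -> `[0, a[%classic `|v|.
Proof.
move=> /osym_itvP/andP[v1 v2].
by rewrite /= in_itv/= normr_ge0 ltr_norml v1.
Qed.

Let abs_le v : osym_itv a v -> `|v| <= a.
Proof. by move=> /O_abs; rewrite /= in_itv/= => /andP[_ /ltW]. Qed.

Let N_abs v : osym_itv a v -> N v = N `|v|.
Proof.
move=> /OE Ov; have [v0|v0] := ger0P v; first by [].
by rewrite N_even.
Qed.

Let mI : measurable (`[0, a[ : set R). Proof. exact: measurable_itv. Qed.

Let radialE v : osym_itv a v -> radial_part a N v = Num.max (N v) 0.
Proof.
by move=> Ov; rewrite (N_abs Ov) /radial_part patchE mem_set//; exact: O_abs.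
Qed.

Lemma measurable_radial_part : measurable_fun [set: R] (radial_part a N).
Proof.
have mmax : measurable_fun `[0, a[ (fun u => Num.max (N u) 0).
  exact: (measurable_maxr mN (measurable_cst (0 : R))).
have mp := (measurable_restrictT _ mI).1 mmax.
by rewrite /radial_part; apply: measurableT_comp.
Qed.

Lemma radial_part_ge0 v : 0 <= radial_part a N v.
Proof.
by rewrite /radial_part patchE; case: ifPn => // _; rewrite le_max lexx orbT.
Qed.

Let mNO : measurable_fun (osym_itv a) N.
Proof.
have mp : measurable_fun [set: R] (N \_ `[0, a[) := (measurable_restrictT _ mI).1 mN.
apply: (@eq_measurable_fun _ _ _ _ _ ((N \_ `[0, a[) \o (@Num.norm _ R))).
  by move=> v /set_mem Ov; rewrite /= (N_abs Ov) patchE mem_set//; exact: O_abs.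
by apply: measurable_funTS; exact: measurableT_comp.
Qed.

Let mNE : measurable_fun (sym_itv a) N.
Proof. exact: measurable_fun_itv_cc mNO. Qed.

Let msuper (D : set R) (h : R -> R) t : measurable D -> measurable_fun D h ->
  measurable (D `&` superlevel h t).
Proof.
move=> mD mh; rewrite (_ : superlevel h t = h @^-1` `]t, +oo[).
  by apply: mh => //; exact: measurable_itv.
by apply/seteqP; split => x /=; rewrite /superlevel/= in_itv/= andbT.
Qed.

Let mu_sym_osym (X : set R) : measurable (sym_itv a `&` X) ->
  mu (sym_itv a `&` X) = mu (osym_itv a `&` X).
Proof.
move=> mX; have mind (D : set R) :
    measurable_fun D (fun v => (\1_(sym_itv a `&` X) v)%:E : \bar R).
  by apply/measurable_EFinP; exact: measurable_indic.
have -> : osym_itv a `&` X = (sym_itv a `&` X) `&` osym_itv a.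
  by apply/seteqP; split => v; [move=> [Ov Xv]; do !split => //; exact: OE|move=> [[]]].
have -> : mu (sym_itv a `&` X) = mu ((sym_itv a `&` X) `&` sym_itv a).
  by rewrite setIAC setIid.
by rewrite -!integral_indic// /sym_itv integral_itv_bndoo.
Qed.

Let super_radial t : 0 <= t ->
  mu (osym_itv a `&` superlevel (radial_part a N) t) = mu (osym_itv a `&` superlevel f t).
Proof.
move=> t0.
have mfE : measurable (sym_itv a `&` superlevel f t).
  by apply: msuper => //; exact: measurable_funTS.
rewrite -[RHS](mu_sym_osym mfE).
have <- : mu (sym_itv a `&` superlevel N t) = mu (sym_itv a `&` superlevel f t).
  exact: Nf.
rewrite mu_sym_osym; last exact: msuper.
congr (mu _); apply/seteqP; split => v [Ov]; rewrite /superlevel/= radialE// lt_max.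
  by rewrite [t < 0]ltNge t0 orbF.
by move=> ->.
Qed.

(** At a level t < 0 the superlevel set of f is all of [-a, a], so that of N has
    full measure. *)
Lemma equimeasurable_ae_ge0 : {ae mu, forall v, osym_itv a v -> 0 <= N v}.
Proof.
have H (n : nat) : {ae mu, forall v, osym_itv a v -> - n.+1%:R^-1 < N v}.
  pose X := sym_itv a `&` superlevel N (- n.+1%:R^-1).
  have mX : measurable X by exact: msuper.
  have muX : mu X = mu (sym_itv a).
    rewrite /X (Nf (- n.+1%:R^-1)); congr (mu _); apply/setIidPl => v _ /=.
    by apply: lt_le_trans (f_ge0 v); rewrite ltrNl oppr0 invr_gt0.
  exists (sym_itv a `\` X); split; first exact: measurableD.
    have XE : sym_itv a `&` X = X by rewrite /X setIA setIid.
    by rewrite measureD// XE [X in (_ - X)%E]muX subee// ge0_fin_numE.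
  move=> v /= /not_implyP[Ov NNv]; split; first exact: OE.
  by move=> [_].
have := ae_foralln H; apply: filterS => v Hv Ov.
rewrite leNgt; apply/negP => Nv0; have [n Hn] := ltr_add_invr Nv0.
move: Hn; rewrite -ltrBrDr sub0r => /lt_trans/(_ (Hv n Ov)).
by rewrite ltxx.
Qed.

Lemma integral_radial_part (q : R -> R) : measurable_fun (osym_itv a) q ->
  (\int[mu]_(v in sym_itv a) (N v * q v)%:E =
   \int[mu]_(v in osym_itv a) (radial_part a N v * q v)%:E)%E.
Proof.
move=> mq.
have mNq : measurable_fun (osym_itv a) (fun v => (N v * q v)%:E).
  by apply/measurable_EFinP; exact: measurable_funM.
rewrite /sym_itv integral_itv_bndoo//; apply: ae_eq_integral => //.
- apply/measurable_EFinP; apply: measurable_funM => //; apply: measurable_funTS.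
  exact: measurable_radial_part.
move: equimeasurable_ae_ge0.
apply: filterS; first exact: (ae_filter_ringOfSetsType mu).
move=> v Hv Ov.
by rewrite radialE// (max_idPl _)// Hv.
Qed.

Let mO1 (h : R -> R) : (\int[mu]_(v in osym_itv a) (h v)%:E =
  \int[mu]_(v in osym_itv a) (h v * cst 1 v)%:E)%E.
Proof. by apply: eq_integral => v _; rewrite mulr1. Qed.

(** The unit mass is inherited by comparison in both directions with the
    constant weight 1. *)
Lemma radial_part_profile : profile a (radial_part a N).
Proof.
split => //; [exact: measurable_radial_part|exact: radial_part_ge0| |].
  by move=> v; rewrite /radial_part normrN.
case: hf => _ _ _ _ <-; apply/eqP; rewrite eq_le (mO1 (radial_part a N)) (mO1 f).
apply/andP; split; apply: (le_integral_rearrangement (w := cst 1)) => //.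
- exact: measurable_radial_part.
- exact: radial_part_ge0.
- exact: measurable_radial_part.
- exact: radial_part_ge0.
- by move=> t t0; rewrite super_radial.
Qed.

Section Kernel.
Context {s : R} (s_ge0 : 0 <= s) (sa : s * a <= 1).

Let w := (fun v => (1 - (s * v) ^+ 2)^-1) \_ (osym_itv a).

Let mw : measurable_fun [set: R] w.
Proof.
apply: (measurable_restrictT _ mO).1; apply: measurable_funTS.
apply: measurableT_comp; first exact: measurable_inv.
apply: measurable_funB; first exact: measurable_cst.
by apply: measurable_funX; exact: mulrl_measurable.
Qed.

Let w_ge0 v : 0 <= w v.
Proof.
rewrite /w patchE; case: ifPn => // /set_mem Ov.
by rewrite invr_ge0 subr_ge0 ltW//; exact: (osym_sqr_lt1 hf).
Qed.

Let w_le x y : osym_itv a x -> osym_itv a y -> `|x| <= `|y| -> w x <= w y.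
Proof.
move=> Ox Oy' xy; rewrite /w !patchE !mem_set//.
have x1 := osym_sqr_lt1 hf s_ge0 sa Ox; have y1 := osym_sqr_lt1 hf s_ge0 sa Oy'.
rewrite lef_pV2 ?posrE ?subr_gt0// lerD2l lerN2 !exprMn ler_wpM2l ?sqr_ge0//.
by rewrite -ler_sqr ?nnegrE// !real_normK ?num_real in xy.
Qed.

Let resolvent_w h : (resolvent a h s =
  \int[mu]_(v in osym_itv a) (h v * w v)%:E)%E.
Proof.
by apply: eq_integral => v Ov; rewrite /w patchE Ov.
Qed.

(** The kernel 1 / (1 - s^2 v^2) grows with |v|, and above every level a
    decreasing rearrangement is closest to the origin. *)
Lemma le_resolvent_decreasing :
  (forall v w, 0 <= v -> v <= w -> w <= a -> N w <= N v) ->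
  (resolvent a (radial_part a N) s <= resolvent a f s)%E.
Proof.
move=> Ndec; rewrite !resolvent_w; apply: le_integral_rearrangement => //.
- exact: measurable_radial_part.
- exact: radial_part_ge0.
move=> t x y Ox Oy' tx _ yt _; apply: w_le => //; rewrite leNgt; apply/negP => yx.
move: tx; rewrite ltNge => /negP; apply; apply: le_trans yt.
rewrite !radialE// (N_abs Ox) (N_abs Oy') ge_max !le_max lexx orbT andbT.
by rewrite (Ndec `|y| `|x|)// ?(ltW yx)// abs_le.
Qed.

Lemma le_resolvent_increasing :
  (forall v w, 0 <= v -> v <= w -> w <= a -> N v <= N w) ->
  (resolvent a f s <= resolvent a (radial_part a N) s)%E.
Proof.
move=> Ninc; rewrite !resolvent_w; apply: le_integral_rearrangement => //.
- exact: measurable_radial_part.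
- exact: radial_part_ge0.
- by move=> t t0; rewrite super_radial.
move=> t x y Ox Oy' _ xt _ ty; apply: w_le => //; rewrite leNgt; apply/negP => yx.
move: ty; rewrite ltNge => /negP; apply; apply: le_trans xt.
rewrite !radialE// (N_abs Ox) (N_abs Oy') ge_max !le_max lexx orbT andbT.
by rewrite (Ninc `|y| `|x|)// ?(ltW yx)// abs_le.
Qed.

End Kernel.

End Rearrangement.

(** * Densities on a compact symmetric velocity set *)

Section VelocitySet.
Context {R : realType} {V : set R} {M : R -> R}.
Context (V_compact : compact V) (V_sym : forall v, V v -> V (- v))
  (M_cont : {within V, continuous M}) (M_ge0 : forall v, V v -> 0 <= M v)
  (M_mass : (\int[mu]_(v in V) (M v)%:E = 1)%E)
  (M_sym : forall v, V v -> M (- v) = M v).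
Local Notation a := (sup V).

Let mV : measurable V. Proof. exact: compact_measurable. Qed.

Lemma velocity_set_nonempty : V !=set0.
Proof.
apply/set0P/eqP => V0; move: M_mass; rewrite V0 integral_set0.
by move=> /eqP; rewrite eqe eq_sym oner_eq0.
Qed.

Lemma velocity_set_ubound : has_ubound V.
Proof. by have [] := compact_has_sup velocity_set_nonempty V_compact. Qed.

Lemma velocity_set_sup : V a.
Proof.
have clV : closed V by apply: compact_closed => //; exact: Rhausdorff.
have := closure_sup velocity_set_nonempty velocity_set_ubound.
by rewrite -((closure_id V).1 clV).
Qed.

Lemma velocity_set_sub : V `<=` sym_itv a.
Proof.
have leV v : V v -> v <= a.
  by move=> Vv; apply: ub_le_sup => //; exact: velocity_set_ubound.
move=> v Vv; rewrite /sym_itv/= in_itv/= leV// andbT lerNl leV//; exact: V_sym.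
Qed.

(** Otherwise V, being symmetric, is contained in {0} and carries no mass. *)
Lemma velocity_set_sup_gt0 : 0 < a.
Proof.
rewrite ltNge; apply/negP => a0; move: M_mass.
rewrite (@integral_Sset1 _ (fun v => (M v)%:E) V 0).
  by move=> /eqP; rewrite eqe eq_sym oner_eq0.
by move=> v /velocity_set_sub; rewrite /sym_itv/= in_itv/= => /andP[v1 v2]; lra.
Qed.

Lemma measurable_density : measurable_fun V M.
Proof. exact: subspace_continuous_measurable_fun. Qed.

Let mf : measurable_fun [set: R] (M \_ V) :=
  (measurable_restrictT _ mV).1 measurable_density.

Lemma integral_velocity_set (q : R -> R) : measurable_fun (osym_itv a) q ->
  (\int[mu]_(v in V) (M v * q v)%:E =
   \int[mu]_(v in osym_itv a) ((M \_ V) v * q v)%:E)%E.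
Proof.
move=> mq; rewrite integral_mkcond.
have <- : (\int[mu]_(v in sym_itv a) ((M \_ V) v * q v)%:E =
    \int[mu]_(v in osym_itv a) ((M \_ V) v * q v)%:E)%E.
  rewrite /sym_itv integral_itv_bndoo//; apply/measurable_EFinP.
  by apply: measurable_funM => //; exact: measurable_funTS.
rewrite [RHS]integral_mkcond; apply: eq_integral => v _; rewrite !patchE.
case: ifPn => [/set_mem Vv|nVv]; first by rewrite mem_set//; exact: velocity_set_sub.
by rewrite mul0r; case: ifP.
Qed.

Lemma velocity_profile : profile a (M \_ V).
Proof.
split => //.
- exact: velocity_set_sup_gt0.
- by move=> v; rewrite patchE; case: ifPn => // /set_mem; exact: M_ge0.
- move=> v; rewrite !patchE; case: ifPn => [/set_mem Vv|nV].
    have Vv' : V v by rewrite -(opprK v); exact: V_sym.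
    by rewrite mem_set// M_sym.
  case: ifPn => // /set_mem Vv; move: nV; rewrite mem_set//; exact: V_sym.
rewrite -M_mass; transitivity (\int[mu]_(v in V) (M v * cst 1 v)%:E)%E.
  by rewrite integral_velocity_set//; apply: eq_integral => v _; rewrite mulr1.
by apply: eq_integral => v _; rewrite mulr1.
Qed.

Lemma velocity_variance (D : R) :
  (\int[mu]_(v in V) (v ^+ 2 * M v)%:E = D%:E)%E ->
  (\int[mu]_(v in osym_itv a) (v ^+ 2 * (M \_ V) v)%:E = D%:E)%E.
Proof.
move=> <-; transitivity (\int[mu]_(v in V) (M v * v ^+ 2)%:E)%E.
  rewrite (integral_velocity_set (q := fun v => v ^+ 2)).
    by apply: eq_integral => v _; rewrite mulrC.
  exact: exprn_measurable.
by apply: eq_integral => v _; rewrite mulrC.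
Qed.

Lemma velocity_minimal_speed (r s0 : R) : 0 < r -> 0 < s0 -> s0 * a <= 1 ->
  branch_speed r a (M \_ V) s0 < a ->
  (forall s, 0 < s -> s * a <= 1 ->
    branch_speed r a (M \_ V) s0 <= branch_speed r a (M \_ V) s) ->
  is_minimal_speed r V M (branch_speed r a (M \_ V) s0).
Proof.
move=> r0 s00 s0a cs0 csmin; apply: (branch_minimal_speed velocity_profile) => //.
move=> lambda c _ _; rewrite -integral_velocity_set//.
exact: measurable_dispersion_kernel.
Qed.

End VelocitySet.

(** * Bounds on the speed *)

Section SpeedBounds.
Context {R : realType} {a : R} {f : R -> R} (hf : profile a f).
Context {D : R} (hD : (\int[mu]_(v in osym_itv a) (v ^+ 2 * f v)%:E = D%:E)%E).

Let a_gt0 : 0 < a. Proof. by case: hf. Qed.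
Let mf : measurable_fun [set: R] f. Proof. by case: hf. Qed.
Let f_ge0 v : 0 <= f v. Proof. by case: hf. Qed.
Let mO : measurable (osym_itv a). Proof. exact: measurable_itv. Qed.
Let msq : measurable_fun (osym_itv a) (fun v => (v ^+ 2 * f v)%:E).
Proof.
apply/measurable_EFinP; apply: measurable_funTS; apply: measurable_funM => //.
Qed.
Let vf_ge0 v : 0 <= v ^+ 2 * f v. Proof. by rewrite mulr_ge0 ?sqr_ge0. Qed.

Lemma variance_le : D <= a ^+ 2.
Proof.
rewrite -lee_fin -hD; case: hf => _ _ _ _ mass1.
rewrite -[leRHS]mule1 -mass1 -ge0_integralZl ?lee_fin ?sqr_ge0//; last 2 first.
- by apply/measurable_EFinP; exact: measurable_funTS.
- by move=> v _; rewrite lee_fin.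
apply: ge0_le_integral => //.
- by move=> v _; rewrite lee_fin.
- apply: emeasurable_funM; first exact: measurable_cst.
  by apply/measurable_EFinP; exact: measurable_funTS.
move=> v /sqr_lt_osym va; rewrite -EFinM lee_fin ler_wpM2r//.
exact: ltW.
Qed.

(** A density with zero variance would vanish almost everywhere off 0. *)
Lemma variance_gt0 : 0 < D.
Proof.
have D0 : 0 <= D.
  by rewrite -lee_fin -hD; apply: integral_ge0 => v _; rewrite lee_fin.
rewrite lt_neqAle D0 andbT eq_sym; apply/eqP => D_eq0.
have /(ae_eq_integral_abs mu mO msq) sq_ae0 :
    (\int[mu]_(v in osym_itv a) `|(v ^+ 2 * f v)%:E| = 0)%E.
  rewrite -[RHS]/(0%:E) -D_eq0 -hD; apply: eq_integral => v _.
  by rewrite gee0_abs// lee_fin.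
have ae_neq0 : {ae mu, forall v : R, v != 0}.
  exists [set 0]; split => //; first exact: lebesgue_measure_set1.
  by move=> v /= /negP; rewrite negbK => /eqP.
case: hf => _ _ _ _ /eqP; rewrite (@ae_eq_integral _ _ _ mu _ (cst 0%E))//.
- by rewrite integral0 eqe eq_sym oner_eq0.
- by apply/measurable_EFinP; exact: measurable_funTS.
move: ae_neq0; apply: filterS2 sq_ae0 => v vf v0 Ov.
have /eqP := vf Ov; rewrite /= eqe mulf_eq0 sqrf_eq0 (negbTE v0)/= => /eqP ->.
by [].
Qed.

Let complement_mul (r k : R) : 0 < 1 + r ->
  (1 - (1 + r)^-1 * k) * (1 + r) = 1 + r - k.
Proof. by move=> r1; rewrite mulrBl mul1r mulrAC mulVf ?gt_eqF// mul1r. Qed.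

Lemma branch_speed_ge_variance (r s : R) : 0 < r -> 0 < s -> s * a <= 1 ->
  (r + s ^+ 2 * D) / ((1 + r) * s) <= branch_speed r a f s.
Proof.
move=> r0 s0 sa; have r1 : 0 < 1 + r by rewrite addr_gt0.
have sD : s ^+ 2 * D <= 1.
  apply: (@le_trans _ _ ((s * a) ^+ 2)).
    by rewrite exprMn ler_wpM2l ?sqr_ge0// variance_le.
  by rewrite expr_le1// mulr_ge0 ?(ltW s0) ?(ltW a_gt0).
have KD := inv_resolvent_le_variance hf hD sD (ltW s0) sa.
rewrite /branch_speed invfM mulrA ler_pM2r ?invr_gt0//.
by rewrite ler_pdivrMr// complement_mul//; lra.
Qed.

Lemma branch_speed_le_edge (r s : R) : 0 < r -> 0 < s -> s * a <= 1 ->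
  branch_speed r a f s <= (r + (s * a) ^+ 2) / ((1 + r) * s).
Proof.
move=> r0 s0 sa; have r1 : 0 < 1 + r by rewrite addr_gt0.
have KD := inv_resolvent_ge_edge hf (ltW s0) sa.
rewrite /branch_speed invfM mulrA ler_pM2r ?invr_gt0//.
by rewrite ler_pdivlMr// complement_mul//; lra.
Qed.

Lemma branch_speed_le_variance (r s : R) : 0 < r -> 0 < s -> s * a < 1 ->
  branch_speed r a f s <=
  (r + s ^+ 2 * D / (1 - (s * a) ^+ 2)) / ((1 + r) * s).
Proof.
move=> r0 s0 sa; have r1 : 0 < 1 + r by rewrite addr_gt0.
have KD := inv_resolvent_ge_variance hf hD (ltW s0) sa.
rewrite /branch_speed invfM mulrA ler_pM2r ?invr_gt0//.
by rewrite ler_pdivlMr// complement_mul//; lra.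
Qed.

(** By the inequality of arithmetic and geometric means,
    r + s^2 D >= 2 s sqrt (r D). *)
Lemma branch_speed_ge_sqrt (r s : R) : 0 < r -> 0 < s -> s * a <= 1 ->
  2 * Num.sqrt (r * D) / (1 + r) <= branch_speed r a f s.
Proof.
move=> r0 s0 sa; have r1 : 0 < 1 + r by rewrite addr_gt0.
apply: le_trans (branch_speed_ge_variance r0 s0 sa).
rewrite ler_pdivlMr ?mulr_gt0// mulrA divfK ?gt_eqF//.
have D0 := variance_gt0.
rewrite sqrtrM ?(ltW r0)// -subr_ge0.
have -> : r + s ^+ 2 * D - 2 * (Num.sqrt r * Num.sqrt D) * s =
   (Num.sqrt r - s * Num.sqrt D) ^+ 2.
  by rewrite sqrrB exprMn !sqr_sqrtr ?ltW//; ring.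
exact: sqr_ge0.
Qed.

(** For r >= 1 the geometric-mean bound would need s = sqrt (r / D), which
    is at least 1 / a.  With x = s sqrt D <= 1 <= r the claim is
    (1 - x) (r - x) >= 0. *)
Lemma branch_speed_ge_std (r s : R) : 1 <= r -> 0 < s -> s * a <= 1 ->
  Num.sqrt D <= branch_speed r a f s.
Proof.
move=> r1 s0 sa; have r0 : 0 < r by exact: lt_le_trans r1.
apply: le_trans (branch_speed_ge_variance r0 s0 sa).
rewrite ler_pdivlMr ?mulr_gt0 ?addr_gt0//.
have D0 := variance_gt0; set q := Num.sqrt D.
have q0 : 0 <= q by exact: sqrtr_ge0.
have qD : D = q ^+ 2 by rewrite sqr_sqrtr// ltW.
have qa : q <= a by rewrite -ler_sqr ?nnegrE ?(ltW a_gt0)// -qD variance_le.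
have sq1 : s * q <= 1 by apply: le_trans sa; rewrite ler_pM2l.
rewrite qD -subr_ge0.
have -> : r + s ^+ 2 * q ^+ 2 - q * ((1 + r) * s) = (1 - s * q) * (r - s * q) by ring.
by rewrite mulr_ge0// subr_ge0// (le_trans sq1).
Qed.

End SpeedBounds.

(** * Dilation of the velocities *)

Section Scaling.
Context {R : realType} {V : set R} {M : R -> R}.
Context (mV : measurable V) (mM : measurable_fun V M)
  (M_ge0 : forall v, V v -> 0 <= M v) (V_sup : has_sup V).
Context {sigma : R} (sigma_gt0 : 0 < sigma).
Local Notation Vs := [set sigma * v | v in V].
Local Notation Ms := (fun v => sigma^-1 * M (sigma^-1 * v)).

Lemma preimage_scale (A : set R) : ( *%R sigma) @^-1` [set sigma * v | v in A] = A.
Proof.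
apply/seteqP; split => [v [u Au]|v Av]; last by exists v.
by move=> /(mulfI (lt0r_neq0 sigma_gt0)) <-.
Qed.

Lemma sup_scale : sup Vs = sigma * sup V.
Proof.
have [V0 Vub] := V_sup.
have Vs_sup : has_sup Vs.
  split; first by case: V0 => v Vv; exists (sigma * v), v.
  exists (sigma * sup V) => _ [v Vv <-]; rewrite ler_pM2l//; exact: ub_le_sup.
apply/eqP; rewrite eq_le; apply/andP; split.
  apply: ge_sup; first by case: Vs_sup.
  by move=> _ [v Vv <-]; rewrite ler_pM2l//; exact: ub_le_sup.
rewrite mulrC -ler_pdivlMr//; apply: ge_sup => // v Vv.
rewrite ler_pdivlMr// mulrC; apply: ub_le_sup; first by case: Vs_sup.
by exists v.
Qed.

Lemma dispI_scale (r lambda c : R) : 0 < lambda ->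
  0 <= c < sup Vs -> lambda <= (sup Vs - c)^-1 ->
  dispI r Vs Ms lambda c = dispI r V M (sigma * lambda) (c / sigma).
Proof.
move=> l0 /andP[c0 cs] lc; rewrite /dispI; congr (_ * _)%E.
have VsE : Vs = ( *%R sigma^-1) @^-1` V.
  apply/seteqP; split => [_ [v Vv <-]|v /= Vv]; first by rewrite /= mulKf ?gt_eqF.
  by exists (sigma^-1 * v) => //; rewrite mulVKf ?gt_eqF.
have ms : measurable_fun [set: R] ( *%R sigma^-1 : R -> R) by exact: mulrl_measurable.
have mVs : measurable Vs.
  by rewrite VsE -[X in measurable X]setTI; exact: ms.
have mMs : measurable_fun Vs (fun v => M (sigma^-1 * v)).
  have mf : measurable_fun [set: R] (M \_ V) := (measurable_restrictT _ mV).1 mM.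
  apply: (@eq_measurable_fun _ _ _ _ _ ((M \_ V) \o ( *%R sigma^-1))).
    by move=> _ /set_mem[v Vv <-]; rewrite /= mulKf ?gt_eqF// patchE mem_set.
  apply: measurable_funTS; apply: measurableT_comp => //; exact: mulrl_measurable.
have den v : Vs v -> 0 <= 1 + lambda * (c - v).
  move=> Vv; have vs : v <= sup Vs.
    apply: ub_le_sup => //; rewrite VsE; case: V_sup => _ [b Vb].
    by exists (sigma * b) => u /Vb; rewrite ler_pdivrMl.
  have : lambda * (sup Vs - c) <= 1 by rewrite -ler_pdivlMr ?subr_gt0// mul1r.
  have : lambda * v <= lambda * sup Vs by rewrite ler_pM2l.
  lra.
have mker (l k : R) (E : set R) : measurable_fun E (fun v => (1 + l * (k - v))^-1).
  exact: measurable_dispersion_kernel.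
rewrite (ge0_integral_scale sigma_gt0 mVs); first last.
- move=> v Vv; rewrite lee_fin divr_ge0 ?den// mulr_ge0 ?invr_ge0 ?(ltW sigma_gt0)//.
  by apply: M_ge0; rewrite VsE in Vv.
- apply/measurable_EFinP; apply: measurable_funM => //.
  by apply: measurable_funM; first exact: measurable_cst.
have denE v : 1 + sigma * lambda * (c / sigma - v) = 1 + lambda * (c - sigma * v).
  by field; rewrite gt_eqF.
rewrite preimage_scale; transitivity (sigma%:E * \int[mu]_(v in V)
   (sigma^-1%:E * (M v / (1 + sigma * lambda * (c / sigma - v)))%:E))%E.
  congr (_ * _)%E; apply: eq_integral => v _.
  rewrite -EFinM mulKf ?gt_eqF// denE mulrA; congr (_ / _)%:E.
rewrite ge0_integralZl//; last 3 first.
- apply/measurable_EFinP; apply: measurable_funM => //; exact: mker.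
- move=> v Vv; rewrite lee_fin denE divr_ge0 ?M_ge0 ?den//.
  by exists v.
- by rewrite lee_fin invr_ge0 ltW.
by rewrite muleA -EFinM divff ?gt_eqF// mul1e.
Qed.

Lemma minimal_speed_scale (r c : R) : is_minimal_speed r V M c ->
  is_minimal_speed r Vs Ms (sigma * c).
Proof.
have si0 : sigma^-1 > 0 by rewrite invr_gt0.
have speedsE (c' : R) : speeds r Vs Ms c' <-> speeds r V M (c' / sigma).
  rewrite /speeds/= sup_scale.
  have ca : (0 <= c' < sigma * sup V) = (0 <= c' / sigma < sup V).
    by rewrite ltr_pdivrMr// [sup V * _]mulrC pmulr_lge0.
  have lE (l : R) : 0 <= c' < sigma * sup V ->
     (0 < l <= (sigma * sup V - c')^-1) = (0 < sigma * l <= (sup V - c' / sigma)^-1).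
    move=> /andP[_ cs]; rewrite pmulr_rgt0//; congr (_ && _).
    have -> : sup V - c' / sigma = sigma^-1 * (sigma * sup V - c').
      by field; rewrite gt_eqF.
    by rewrite invfM invrK ler_pM2l.
  split => -[cs [l [lc I1]]].
    split; first by rewrite -ca.
    exists (sigma * l); rewrite -lE//; split => //.
    rewrite -I1 dispI_scale// ?sup_scale//.
      by case/andP: lc.
    by case/andP: lc.
  rewrite -ca in cs; split => //; exists (l / sigma).
  have lc' : 0 < l / sigma <= (sigma * sup V - c')^-1.
    by rewrite lE// mulrCA divff ?gt_eqF// mulr1.
  split => //; rewrite dispI_scale// ?sup_scale//.
  - by rewrite mulrCA divff ?gt_eqF// mulr1.
  - by case/andP: lc'.
  - by case/andP: lc'.
move=> [cV cmin]; split.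
  by apply/speedsE; rewrite mulrAC divff ?gt_eqF// mul1r.
by move=> c' /speedsE/cmin; rewrite ler_pdivlMr// mulrC.
Qed.

End Scaling.

(** * Speeds of rearranged densities *)

Lemma le_branch_speed (R : realType) (a r s : R) (f g : R -> R) :
  profile a f -> profile a g -> 0 < r -> 0 < s -> s * a <= 1 ->
  (resolvent a f s <= resolvent a g s)%E ->
  branch_speed r a f s <= branch_speed r a g s.
Proof.
move=> hf hg r0 s0 sa fg.
rewrite ler_pM2r ?invr_gt0// lerD2l lerN2 ler_pM2l ?invr_gt0 ?addr_gt0//.
have [gy|gy] := eqVneq (resolvent a g s) +oo%E.
  by rewrite (inv_resolvent_infty gy) (inv_resolvent_ge0 hf)// ltW.
have {}gy : (resolvent a g s < +oo)%E by rewrite ltey.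
have [Eg g1 _] := inv_resolvent_fin hg (ltW s0) sa gy.
have [Ef f1 _] := inv_resolvent_fin hf (ltW s0) sa (le_lt_trans fg gy).
rewrite lef_pV2 ?posrE ?(lt_le_trans _ g1) ?(lt_le_trans _ f1)//.
by rewrite -lee_fin -Eg -Ef.
Qed.

Section RearrangedSpeed.
Context {R : realType} {a r : R} {f N : R -> R}.
Context (hf : profile a f) (r_gt0 : 0 < r).
Context (N_even : forall v, sym_itv a v -> N (- v) = N v).
Context (Nf : equimeasurable_on (sym_itv a) N f).

Let a_gt0 : 0 < a. Proof. by case: hf. Qed.

Let sup_sym_itv : sup (sym_itv a) = a.
Proof. by rewrite /sym_itv sup_itvcc// ge0_cp// ltW. Qed.

Lemma rearranged_minimal_speed (mN : measurable_fun `[0, a[ N) :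
  exists s0, [/\ 0 < s0, s0 * a <= 1,
    is_minimal_speed r (sym_itv a) N
      (branch_speed r a (radial_part a N) s0)
    & forall s, 0 < s -> s * a <= 1 ->
      branch_speed r a (radial_part a N) s0 <=
      branch_speed r a (radial_part a N) s].
Proof.
have hN := radial_part_profile hf N_even mN Nf.
have [s0 [s00 s0a cs0 csmin]] := branch_speed_min hN r_gt0.
exists s0; split => //; apply: (branch_minimal_speed hN) => // lambda c _ _.
rewrite (integral_radial_part hf N_even mN Nf)//.
exact: measurable_dispersion_kernel.
Qed.

(** Composition with this map makes N monotone on the whole line, hence
    measurable. *)
Let clamp (v : R) : R := Num.max 0 (Num.min v a).

Let clamp_id v : `[0, a[%classic v -> clamp v = v.
Proof.
rewrite /= in_itv/= => /andP[v0 va].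
by rewrite /clamp min_l ?ltW// max_r.
Qed.

Let clamp_itv v : 0 <= clamp v <= a.
Proof. by rewrite /clamp le_max lexx/= ge_max ltW//= ge_min lexx orbT. Qed.

Let clamp_le v w : v <= w -> clamp v <= clamp w.
Proof.
move=> vw; rewrite /clamp ge_max le_max lexx/= le_max; apply/orP; right.
by rewrite le_min ge_min vw/= ge_min lexx orbT.
Qed.

Lemma decreasing_minimal_speed s0 :
  (forall v w, 0 <= v -> v <= w -> w <= a -> N w <= N v) ->
  0 < s0 -> s0 * a <= 1 ->
  exists c, is_minimal_speed r (sym_itv a) N c /\ c <= branch_speed r a f s0.
Proof.
move=> Ndec s00 s0a.
have mN : measurable_fun `[0, a[ N.
  apply: (@eq_measurable_fun _ _ _ _ _ (N \o clamp)).
    by move=> v /set_mem Iv; rewrite /= clamp_id.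
  apply: nonincreasing_measurable; first exact: measurable_itv.
  move=> v w vw /=; case/andP: (clamp_itv v) => v0 va.
  by case/andP: (clamp_itv w) => w0 wa; apply: Ndec => //; exact: clamp_le.
have hN := radial_part_profile hf N_even mN Nf.
have [s1 [s10 s1a csP csmin]] := rearranged_minimal_speed mN.
eexists; split; first exact: csP.
apply: (le_trans (csmin _ s00 s0a)); apply: le_branch_speed => //.
exact: (le_resolvent_decreasing hf N_even mN Nf (ltW s00) s0a Ndec).
Qed.

Lemma increasing_minimal_speed c :
  (forall v w, 0 <= v -> v <= w -> w <= a -> N v <= N w) ->
  (forall s, 0 < s -> s * a <= 1 -> c <= branch_speed r a f s) ->
  exists c', is_minimal_speed r (sym_itv a) N c' /\ c <= c'.
Proof.
move=> Ninc cmin.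
have mN : measurable_fun `[0, a[ N.
  apply: (@eq_measurable_fun _ _ _ _ _ (N \o clamp)).
    by move=> v /set_mem Iv; rewrite /= clamp_id.
  apply: nondecreasing_measurable; first exact: measurable_itv.
  move=> v w vw /=; case/andP: (clamp_itv v) => v0 va.
  by case/andP: (clamp_itv w) => w0 wa; apply: Ninc => //; exact: clamp_le.
have hN := radial_part_profile hf N_even mN Nf.
have [s1 [s10 s1a csP csmin]] := rearranged_minimal_speed mN.
eexists; split; first exact: csP.
apply: (le_trans (cmin _ s10 s1a)); apply: le_branch_speed => //.
exact: (le_resolvent_increasing hf N_even mN Nf (ltW s10) s1a Ninc).
Qed.

End RearrangedSpeed.

(** * Linearization of the rescaled equation *)

Section Linearization.
Context {R : realType} {V : set R} {M : R -> R}.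
Context (mV : measurable V) (mM : measurable_fun V M)
  (M_ge0 : forall v, V v -> 0 <= M v).
Context {r eps lambda c : R} (r_gt0 : 0 < r) (eps_gt0 : 0 < eps)
  (lambda_gt0 : 0 < lambda).
Local Notation den v := (1 + eps ^+ 2 * lambda * (c - v / eps)).

Lemma rho_scale (F : R -> R) (k : R) : mu.-integrable V (EFin \o F) ->
  (\int[mu]_(v in V) (F v)%:E = 1)%E -> rho V (fun v => k * F v) = k.
Proof.
move=> iF F1; rewrite /rho /Rintegral.
under eq_integral do rewrite EFinM.
rewrite integralZl// F1 mule1//.
Qed.

Lemma is_derive_expR_affine (p q m x : R) :
  is_derive x (1 : R) (fun y => p * expR (q * y - m)) (p * (q * expR (q * x - m))).
Proof.
have dq : is_derive x (1 : R) (fun y => q * y - m) q.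
  apply/is_derive1_caratheodory; exists (cst q); split => //.
  - by move=> z; rewrite /cst; ring.
  - exact: cvg_cst.
have := is_deriveZ p (@is_derive1_comp R expR (fun y => q * y - m) x _ _
  (is_derive_expR (q * x - m)) dq).
move=> /is_derive_eq; apply; rewrite /GRing.scale/=.
by rewrite [expR _ * q]mulrC.
Qed.

(** On exponentials the residual is a quadratic polynomial in the amplitude d;
    its linear coefficient is the linearized equation. *)
Lemma rescaled_residual_exp (F : R -> R) (d t x v : R) :
  mu.-integrable V (EFin \o F) -> (\int[mu]_(v in V) (F v)%:E = 1)%E ->
  let A := expR (- lambda * (x - c * t)) in
  rescaled_residual r V M eps
    (fun t' x' v' => d * (expR (- lambda * (x' - c * t')) * F v')) t x v =
  d * (A * (den v * F v - (1 + eps ^+ 2 * r) * M v))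
    + d ^+ 2 * (eps ^+ 2 * r * A ^+ 2 * F v).
Proof.
move=> iF F1 A; rewrite /rescaled_residual.
have -> : rho V (fun v' => d * (expR (- lambda * (x - c * t)) * F v')) = d * A.
  rewrite -[RHS](rho_scale (d * A) iF F1); congr (rho V _).
  by apply/funext => u; rewrite mulrA.
have dt : is_derive (t : R) (1 : R)
    (fun s => d * (expR (- lambda * (x - c * s)) * F v)) (d * (lambda * c * A * F v)).
  have -> : (fun s => d * (expR (- lambda * (x - c * s)) * F v)) =
      (fun s => d * F v * expR (lambda * c * s - lambda * x)).
    by apply/funext => s; rewrite mulrCA mulrC; congr (_ * expR _); ring.
  apply: (is_derive_eq (is_derive_expR_affine (d * F v) (lambda * c) (lambda * x) t)).
  rewrite /A (_ : - lambda * (x - c * t) = lambda * c * t - lambda * x); last by ring.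
  by ring.
have dx : is_derive (x : R) (1 : R)
    (fun y => d * (expR (- lambda * (y - c * t)) * F v)) (d * (- lambda * A * F v)).
  have -> : (fun y => d * (expR (- lambda * (y - c * t)) * F v)) =
      (fun y => d * F v * expR (- lambda * y - (- lambda * c * t))).
    by apply/funext => s; rewrite mulrCA mulrC; congr (_ * expR _); ring.
  apply: (is_derive_eq
    (is_derive_expR_affine (d * F v) (- lambda) (- lambda * c * t) x)).
  rewrite /A (_ : - lambda * (x - c * t) = - lambda * x - - lambda * c * t); last by ring.
  by ring.
rewrite !derive1E (@derive_val _ _ _ _ _ _ _ dt) (@derive_val _ _ _ _ _ _ _ dx).
by rewrite -/A; field; rewrite gt_eqF.
Qed.

Lemma is_derive_quadratic0 (B C : R) :
  is_derive (0 : R) (1 : R) (fun d : R => d * B + d ^+ 2 * C) B.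
Proof.
apply/is_derive1_caratheodory; exists (fun z => B + z * C); split.
- by move=> z; ring.
- apply: cvgD; first exact: cvg_cst.
  by apply: cvgMl; exact: cvg_id.
- by rewrite mul0r addr0.
Qed.

Lemma solves_linearization_exp (F : R -> R) :
  mu.-integrable V (EFin \o F) -> (\int[mu]_(v in V) (F v)%:E = 1)%E ->
  solves_linearization_at0 r V M eps
    (fun t x v => expR (- lambda * (x - c * t)) * F v) <->
  {ae mu, forall v, V v -> den v * F v = (1 + eps ^+ 2 * r) * M v}.
Proof.
move=> iF F1.
have eqv t x v : is_derive (0 : R) (1 : R) (fun d : R =>
      rescaled_residual r V M eps
        (fun t' x' v' => d * (expR (- lambda * (x' - c * t')) * F v')) t x v) (0 : R)
    <-> den v * F v = (1 + eps ^+ 2 * r) * M v.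
  under eq_fun do rewrite rescaled_residual_exp//.
  set A := expR _; set B := A * _; set C := _ * F v.
  have dB := is_derive_quadratic0 B C; split.
    move=> d0; have : B = 0.
      by rewrite -(@derive_val _ _ _ _ _ _ _ dB) (@derive_val _ _ _ _ _ _ _ d0).
    move/eqP; rewrite mulf_eq0 gt_eqF ?expR_gt0//= subr_eq0 => /eqP //.
  move=> E; have B0 : B = 0 by rewrite /B E subrr mulr0.
  by rewrite -[X in is_derive _ _ _ X]B0.
split => [/(_ 0 0)|H t x].
  apply: filterS; first exact: (ae_filter_ringOfSetsType mu).
  by move=> v H Vv; apply/(eqv 0 0)/H.
move: H; apply: filterS; first exact: (ae_filter_ringOfSetsType mu).
by move=> v H Vv; apply/eqv/H.
Qed.

(** The linearized equation determines F = (1 + eps^2 r) M / den wherever the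
    denominator does not vanish, that is, off a single velocity; the dispersion
    relation says that this F has unit mass. *)
Lemma has_exponential_solutionP : admissible_eps V eps lambda c ->
  has_exponential_solution r V M eps lambda c <->
  dispI_eps r V M eps lambda c = 1%E.
Proof.
move=> adm.
pose G v := (1 + eps ^+ 2 * r) * (M v / den v).
have k0 : 0 < 1 + eps ^+ 2 * r by rewrite addr_gt0// mulr_gt0// exprn_gt0.
have mMden : measurable_fun V (fun v => M v / den v).
  apply: measurable_funM => //.
  have -> : (fun v => (den v)^-1) = (fun v => (1 + eps * lambda * (eps * c - v))^-1).
    by apply/funext => v; congr (_^-1); field; rewrite gt_eqF.
  exact: measurable_dispersion_kernel.
have Mden0 v : V v -> 0 <= M v / den v.
  by move=> Vv; rewrite divr_ge0 ?M_ge0//; exact: adm.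
have mG : measurable_fun V G by apply: measurable_funM => //; exact: measurable_cst.
have G0 v : V v -> 0 <= G v by move=> Vv; rewrite mulr_ge0 ?Mden0// ltW.
have IG : (\int[mu]_(v in V) (G v)%:E = dispI_eps r V M eps lambda c)%E.
  rewrite /dispI_eps -ge0_integralZl ?lee_fin ?(ltW k0)//.
  exact/measurable_EFinP.
pose v0 := (1 + eps ^+ 2 * lambda * c) / (eps * lambda).
have den_ae : {ae mu, forall v, den v != 0}.
  exists [set v0]; split => //; first exact: lebesgue_measure_set1.
  move=> v /= /negP; rewrite negbK => /eqP dv; rewrite /v0.
  apply: (@mulIf _ (eps * lambda)); first by rewrite gt_eqF// mulr_gt0.
  rewrite divfK; last by rewrite gt_eqF// mulr_gt0.
  have : den v = 1 + eps ^+ 2 * lambda * c - v * (eps * lambda).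
    by field; rewrite gt_eqF.
  by rewrite dv => /esym/eqP; rewrite subr_eq0 => /eqP ->.
split.
  move=> [F [F0 iF F1 /(solves_linearization_exp iF F1) HF]].
  rewrite -F1 -IG; apply: ae_eq_integral => //.
  - exact/measurable_EFinP.
  - exact: measurable_int iF.
  move: HF den_ae; apply: filterS2; first exact: (ae_filter_ringOfSetsType mu).
  move=> v HF dv Vv; congr EFin.
  by rewrite /G mulrA -HF// mulrAC divff// mul1r.
move=> I1; rewrite I1 in IG.
have iG : mu.-integrable V (EFin \o G).
  apply/integrableP; split; first exact/measurable_EFinP.
  suff -> : (\int[mu]_(v in V) `|(EFin \o G) v| = 1)%E by rewrite ltry.
  rewrite -IG; apply: eq_integral => v /set_mem Vv.
  by rewrite /= ger0_norm// G0.
exists G; split => //; apply/(solves_linearization_exp iG IG).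
move: den_ae; apply: filterS; first exact: (ae_filter_ringOfSetsType mu).
move=> v dv Vv; by rewrite /G mulrCA [den v * _]mulrC divfK.
Qed.

End Linearization.

(** * The diffusion limit *)

(** The substitution is lambda -> eps lambda, c -> eps c; admissibility is
    decided at the largest velocity. *)
Lemma speeds_epsE (R : realType) (r eps c : R) (V : set R) (M : R -> R) :
  V (sup V) -> has_ubound V -> 0 < eps ->
  speeds_eps r V M eps c <-> speeds (eps ^+ 2 * r) V M (eps * c).
Proof.
move=> Va Vub eps0.
have cE : (0 <= c < sup V / eps) = (0 <= eps * c < sup V).
  by rewrite ltr_pdivlMr// [c * eps]mulrC pmulr_rge0.
have denE l v : 1 + eps ^+ 2 * l * (c - v / eps) = 1 + eps * l * (eps * c - v).
  by field; rewrite gt_eqF.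
have dispE l : dispI_eps r V M eps l c = dispI (eps ^+ 2 * r) V M (eps * l) (eps * c).
  by congr (_ * _)%E; apply: eq_integral => v _; rewrite denE.
have admE l : 0 < l -> eps * c < sup V ->
    admissible_eps V eps l c <-> eps * l <= (sup V - eps * c)^-1.
  move=> l0 ca; have ac : 0 < sup V - eps * c by rewrite subr_gt0.
  have el0 : 0 < eps * l by rewrite mulr_gt0.
  rewrite -[_^-1]mul1r ler_pdivlMr//; split.
    by move=> /(_ _ Va); rewrite denE; lra.
  move=> H v Vv; rewrite denE.
  have : eps * l * v <= eps * l * sup V by rewrite ler_pM2l// ub_le_sup.
  by lra.
split.
- move=> [ca [l [l0 adm I1]]]; rewrite cE in ca; split => //.
  exists (eps * l); rewrite -dispE mulr_gt0//=; split => //.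
  by apply/admE => //; case/andP: ca.
- move=> [ca [l [/andP[l0 la] I1]]]; split; first by rewrite cE.
  have l0' : 0 < l / eps by rewrite divr_gt0.
  have lE : eps * (l / eps) = l by rewrite mulrCA divff ?gt_eqF// mulr1.
  exists (l / eps); split => //; last by rewrite dispE lE.
  by apply/admE => //; [case/andP: ca|rewrite lE].
Qed.

Section DiffusionLimit.
Context {R : realType} {a D r : R} {f : R -> R}.
Context (hf : profile a f) (r_gt0 : 0 < r).
Context (hD : (\int[mu]_(v in osym_itv a) (v ^+ 2 * f v)%:E = D%:E)%E).
Context {smin : R -> R}.
Context (smin_gt0 : forall eps, 0 < eps -> 0 < smin eps)
  (smin_le : forall eps, 0 < eps -> smin eps * a <= 1)
  (smin_min : forall eps s, 0 < eps -> 0 < s -> s * a <= 1 ->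
    branch_speed (eps ^+ 2 * r) a f (smin eps) <= branch_speed (eps ^+ 2 * r) a f s).

Let a_gt0 : 0 < a. Proof. by case: hf. Qed.
Let D_gt0 : 0 < D. Proof. exact: (variance_gt0 hf hD). Qed.
(** The minimizer of k -> r / k + k D, which is the limit of C(eps k) / eps when
    r is replaced by eps^2 r. *)
Let k := Num.sqrt (r / D).
Let k_gt0 : 0 < k. Proof. by rewrite sqrtr_gt0 divr_gt0. Qed.

Let lower_bound_le eps : 0 < eps ->
  2 * Num.sqrt (r * D) / (1 + eps ^+ 2 * r) <=
  branch_speed (eps ^+ 2 * r) a f (smin eps) / eps.
Proof.
move=> e0; have re0 : 0 < eps ^+ 2 * r by rewrite mulr_gt0// exprn_gt0.
rewrite ler_pdivlMr//.
have sqE : Num.sqrt (eps ^+ 2 * r * D) = eps * Num.sqrt (r * D).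
  by rewrite -mulrA sqrtrM ?sqr_ge0// sqrtr_sqr gtr0_norm.
have := branch_speed_ge_sqrt hf hD re0 (smin_gt0 e0) (smin_le e0).
rewrite sqE; apply: le_trans.
by rewrite le_eqVlt; apply/orP; left; apply/eqP; ring.
Qed.

Let upper_bound_ge eps : 0 < eps -> eps * (k * a) < 1 ->
  branch_speed (eps ^+ 2 * r) a f (smin eps) / eps <=
  (r + r / (1 - (eps * (k * a)) ^+ 2)) / k.
Proof.
move=> e0 eka; have re0 : 0 < eps ^+ 2 * r by rewrite mulr_gt0// exprn_gt0.
have s0 : 0 < eps * k by rewrite mulr_gt0.
have sa : eps * k * a < 1 by rewrite -mulrA.
have X0 : 0 < 1 - (eps * (k * a)) ^+ 2.
  by rewrite subr_gt0 expr_lt1// !mulr_ge0// ltW.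
rewrite ler_pdivrMr//; apply: (le_trans (smin_min e0 s0 (ltW sa))).
apply: (le_trans (branch_speed_le_variance hf hD re0 s0 sa)).
have kD : k ^+ 2 * D = r by rewrite /k sqr_sqrtr ?divr_ge0 ?ltW// divfK// gt_eqF.
rewrite exprMn -[eps ^+ 2 * k ^+ 2 * D]mulrA kD -[eps * k * a]mulrA.
have -> : (eps ^+ 2 * r + eps ^+ 2 * r / (1 - (eps * (k * a)) ^+ 2)) /
   ((1 + eps ^+ 2 * r) * (eps * k)) =
   (r + r / (1 - (eps * (k * a)) ^+ 2)) / k * eps / (1 + eps ^+ 2 * r).
  by field; rewrite !gt_eqF// addr_gt0.
rewrite ler_pdivrMr ?addr_gt0// ler_peMr//; last by rewrite lerDl ltW.
rewrite !mulr_ge0 ?invr_ge0 ?(ltW k_gt0) ?(ltW e0)//.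
by rewrite addr_ge0 ?divr_ge0 ?(ltW r_gt0) ?(ltW X0).
Qed.

Lemma diffusion_limit :
  branch_speed (eps ^+ 2 * r) a f (smin eps) / eps @[eps --> 0^'+] -->
  2 * Num.sqrt (r * D).
Proof.
have cvg_id0 : (eps : R) @[eps --> 0^'+] --> (0 : R).
  by apply: cvg_at_right_filter; exact: cvg_id.
apply: (@squeeze_cvgr _ _ _ _
  (fun eps => 2 * Num.sqrt (r * D) / (1 + eps ^+ 2 * r))
  (fun eps => (r + r / (1 - (eps * (k * a)) ^+ 2)) / k)).
- near=> eps.
  have e0 : 0 < eps by near: eps; exact: nbhs_right_gt.
  rewrite lower_bound_le// upper_bound_ge// -ltr_pdivlMr ?mulr_gt0//.
  by near: eps; apply: nbhs_right_lt; rewrite divr_gt0// mulr_gt0.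
- rewrite [X in _ --> X](_ : _ = 2 * Num.sqrt (r * D) / (1 + 0 * 0 * r)); last first.
    by rewrite !mul0r addr0 divr1.
  apply: cvgMr; apply: cvgV; first by rewrite !mul0r addr0 oner_neq0.
  apply: cvgD; first exact: cvg_cst.
  by apply: cvgMl; apply: cvgM.
- have -> : 2 * Num.sqrt (r * D) = (r + r / (1 - 0 * (k * a) * (0 * (k * a)))) / k.
    rewrite !mul0r subr0 divr1.
    have rk : Num.sqrt (r * D) * k = r.
      rewrite /k -sqrtrM ?mulr_ge0 ?ltW//.
      have -> : r * D * (r / D) = r ^+ 2 by field; rewrite gt_eqF.
      by rewrite sqrtr_sqr gtr0_norm.
    by apply: (@mulIf _ k); rewrite ?gt_eqF// divfK ?gt_eqF// -mulrA rk; ring.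
  apply: cvgMl; apply: cvgD; first exact: cvg_cst.
  apply: cvgMr; apply: cvgV; first by rewrite !mul0r subr0 oner_neq0.
  apply: cvgB; first exact: cvg_cst.
  by apply: cvgM; apply: cvgMl.
Unshelve. all: by end_near. Qed.

End DiffusionLimit.

Unset Implicit Arguments.
Set Strict Implicit.
Set Printing Implicit Defensive.

Theorem proposition1p5 (R : realType) (r D : R) (V : set R) (M : R -> R)
  (r_gt0 : 0 < r)
  (V_compact : compact V)
  (V_sym : forall v, V v -> V (- v))
  (M_cont : {within V, continuous M})
  (M_ge0 : forall v, V v -> 0 <= M v)
  (M_supp : supp_on V M = V)
  (M_mass : (\int[mu]_(v in V) (M v)%:E = 1)%E)
  (M_mean : (\int[mu]_(v in V) (v * M v)%:E = 0)%E)
  (M_var : (\int[mu]_(v in V) (v ^+ 2 * M v)%:E = D%:E)%E)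
  (M_sym : forall v, V v -> M (- v) = M v) :
  exists cstar : R,
    is_minimal_speed r V M cstar /\
    [/\ (* (a) *)
        forall sigma : R, 0 < sigma ->
          is_minimal_speed r [set sigma * v | v in V]
            (fun v => sigma^-1 * M (sigma^-1 * v)) (sigma * cstar),
        (* (b) *)
        (forall N, decreasing_rearrangement V M N ->
           exists c, is_minimal_speed r (sym_itv (sup V)) N c /\ c <= cstar) /\
        (forall N, increasing_rearrangement V M N ->
           exists c, is_minimal_speed r (sym_itv (sup V)) N c /\ cstar <= c),
        (* (c) *)
        (r < 1 ->
           2 * Num.sqrt (r * D) / (1 + r) <= cstar
             <= 2 * Num.sqrt r / (1 + r) * sup V) /\
        (1 <= r -> Num.sqrt D <= cstar <= sup V)
      & (* (d) *)
        (forall eps lambda c : R, 0 < eps -> 0 < lambda ->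
           admissible_eps V eps lambda c ->
           (has_exponential_solution r V M eps lambda c <->
            dispI_eps r V M eps lambda c = 1%E)) /\
        (exists ceps : R -> R,
           (forall eps, 0 < eps -> is_min (speeds_eps r V M eps) (ceps eps)) /\
           ceps eps @[eps --> 0^'+] --> 2 * Num.sqrt (r * D))].
Proof.
set a := sup V; pose f := M \_ V.
have mV : measurable V by exact: compact_measurable.
have V0 : V !=set0 := velocity_set_nonempty M_mass.
have Vub : has_ubound V := velocity_set_ubound V_compact M_mass.
have hf : profile a f := velocity_profile V_compact V_sym M_cont M_ge0 M_mass M_sym.
have a_gt0 : 0 < a by case: hf.
have hD := velocity_variance V_compact V_sym M_cont M_mass M_var.
have [s0 [s0_gt0 s0a cs0 csmin]] := branch_speed_min hf r_gt0.
have cP : is_minimal_speed r V M (branch_speed r a f s0).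
  exact: velocity_minimal_speed.
exists (branch_speed r a f s0); split => //; split.
- move=> sigma sigma_gt0; apply: minimal_speed_scale => //.
  exact: measurable_density.
- split=> N [N_even N_mono N_equi].
  + exact: (decreasing_minimal_speed hf r_gt0 N_even N_equi N_mono s0_gt0 s0a).
  + exact: (increasing_minimal_speed hf r_gt0 N_even N_equi N_mono csmin).
- split=> r1; apply/andP; split.
  + exact: (branch_speed_ge_sqrt hf hD r_gt0 s0_gt0 s0a).
  + have q0 : 0 < Num.sqrt r by rewrite sqrtr_gt0.
    have q1 : Num.sqrt r <= 1 by rewrite -sqrtr1 ler_sqrt ?ltr01// ltW.
    have sa : Num.sqrt r / a * a = Num.sqrt r by rewrite divfK// gt_eqF.
    have s_gt0 : 0 < Num.sqrt r / a by rewrite divr_gt0.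
    have s_le : Num.sqrt r / a * a <= 1 by rewrite sa.
    apply: (le_trans (csmin _ s_gt0 s_le)).
    apply: (le_trans (branch_speed_le_edge hf r_gt0 s_gt0 s_le)).
    rewrite sa le_eqVlt; apply/orP; left; apply/eqP.
    have qr : Num.sqrt r ^+ 2 = r by rewrite sqr_sqrtr// ltW.
    have r1_neq0 : 1 + r != 0 by rewrite gt_eqF// addr_gt0.
    move: (Num.sqrt r) q0 qr => q q0 qr; rewrite -qr in r1_neq0 *.
    by field; rewrite r1_neq0 !gt_eqF.
  + exact: (branch_speed_ge_std hf hD r1 s0_gt0 s0a).
  + exact: ltW.
- split.
    move=> eps lambda c eps_gt0 lambda_gt0; apply: has_exponential_solutionP => //.
    exact: measurable_density.
  have smin_ex (eps : R) : exists s : R, 0 < eps ->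
      [/\ 0 < s, s * a <= 1, branch_speed (eps ^+ 2 * r) a f s < a &
        forall s', 0 < s' -> s' * a <= 1 ->
          branch_speed (eps ^+ 2 * r) a f s <= branch_speed (eps ^+ 2 * r) a f s'].
    have [e0|] := ltP 0 eps; last by exists 0.
    have re0 : 0 < eps ^+ 2 * r by rewrite mulr_gt0// exprn_gt0.
    by have [s] := branch_speed_min hf re0; exists s.
  have [smin sminP] := choice smin_ex.
  exists (fun eps => branch_speed (eps ^+ 2 * r) a f (smin eps) / eps); split.
    move=> eps e0; have [s1 s1a cs1 cs1min] := sminP eps e0.
    have re0 : 0 < eps ^+ 2 * r by rewrite mulr_gt0// exprn_gt0.
    have [cV cmin] : is_minimal_speed (eps ^+ 2 * r) V M
      (branch_speed (eps ^+ 2 * r) a f (smin eps)) by exact: velocity_minimal_speed.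
    have Va : V a := velocity_set_sup V_compact M_mass.
    split.
      apply/(speeds_epsE _ _ _ Va Vub e0).
      by rewrite mulrCA divff ?gt_eqF// mulr1.
    move=> c /(speeds_epsE _ _ _ Va Vub e0)/cmin cle.
    by rewrite ler_pdivrMr// [c * eps]mulrC.
  apply: (diffusion_limit hf r_gt0 hD) => eps.
  + by case/sminP.
  + by case/sminP.
  + by move=> s e0; have [_ _ _] := sminP eps e0; exact.
Qed.
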